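(* Let $X^{(1)},\dots,X^{(n)}$ be i.i.d. $\mathcal N(0,\Sigma^* )$ in $\mathbb R^d$. Suppose that Assumptions 1, 2 and 3 (stated in the context) hold, that $n\gtrsim s\log d$, and take $\lambda$ such that $\lambda\asymp\sqrt{\log d/n}$ (with suitably chosen constant). Then, with probability at least $1-8/d$, the estimators $\widehat\Psi^{(\ell)}$ satisfy $$\big\|\widehat\Psi^{(\ell)}-\Psi^*\big\|_F\le 8\|\Psi^*\|_2^2\,\big\|\nabla\mathcal L(\Psi^* )_S\big\|_F+\tfrac12\big\|\widehat\Psi^{(\ell-1)}-\Psi^*\big\|_F,\qquad 1\le \ell\le T.$$ Moreover, if $T\gtrsim\log(\lambda\sqrt n)\gtrsim\log\log d$, then $$\big\|\widehat\Psi^{(T)}-\Psi^*\big\|_F=\mathcal O_{\mathbb P}\big(\sqrt{s/n}\big).$$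
   Context: Notation. $\|\cdot\|_F$ is the Frobenius norm, $\|\cdot\|_2$ the spectral norm, $\|\cdot\|_\infty$ the $\ell_\infty\to\ell_\infty$ operator norm (maximum absolute row sum), $\langle A,B\rangle=\mathrm{tr}(A^{\mathrm T}B)$, $\odot$ the Hadamard product, $\|A\|_{1,\mathrm{off}}=\sum_{i\ne j}|A_{ij}|$, $a\vee b=\max\{a,b\}$. For an index set $\mathcal E$, $A_{\mathcal E}$ agrees with $A$ on $\mathcal E$ and is $0$ elsewhere. $\mathcal S_+^d$ is the set of symmetric positive definite $d\times d$ matrices. Model. $\Sigma^*$ is positive definite, $\Theta^*=(\Sigma^* )^{-1}$, $W^2=\mathrm{diag}(\Sigma^* )$ (diagonal part), $C^*=W^{-1}\Sigma^*W^{-1}$ is the correlation matrix and $\Psi^*=(C^* )^{-1}$. $S=\{(i,j):i\ne j,\ \Theta^*_{ij}\ne0\}$, which is also the off-diagonal support of $\Psi^*$. Estimators. $\widehat\Sigma=n^{-1}\sum_{i=1}^n X^{(i)}(X^{(i)})^{\mathrm T}$, $\widehat W^2=\mathrm{diag}(\widehat\Sigma)$, $\widehat C=\widehat W^{-1}\widehat\Sigma\widehat W^{-1}$, and $\mathcal L(\Psi)=\langle\Psi,\widehat C\rangle-\log\det\Psi$, so $\nabla\mathcal L(\Psi^* )=\widehat C-C^*$. Given $\lambda>0$ and a weight function $\mathrm w$, put $\widehat\Psi^{(0)}=0$, so that $\lambda^{(0)}_{ij}=\lambda$ for $i\neq j$, and for $\ell=1,\dots,T$ $$\widehat\Psi^{(\ell)}=\operatorname*{argmin}_{\Psi\in\mathcal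 S_+^d}\big\{\langle\Psi,\widehat C\rangle-\log\det\Psi+\|\lambda^{(\ell-1)}\odot\Psi\|_{1,\mathrm{off}}\big\},\qquad \lambda^{(\ell)}_{ij}=\lambda\,\mathrm w\big(|\widehat\Psi^{(\ell)}_{ij}|\big)\ (i\ne j).$$ Assumptions. Let $c=2\big(32\|\Psi^*\|_2^2+\|\Sigma^*\|_\infty^2\vee1\big)$ and $u=c\lambda$. Assumption 1: $|S|\le s$, $\|\Sigma^*\|_\infty\le M<\infty$, $0<\varepsilon_1\le\sigma_{\min}\le\sigma_{\max}\le1/\varepsilon_1<\infty$, and $0<\varepsilon_2\le\lambda_{\min}(\Theta^* )\le\lambda_{\max}(\Theta^* )\le1/\varepsilon_2<\infty$, where $\sigma_{\max}^2=\max_j\Sigma^*_{jj}$, $\sigma_{\min}^2=\min_j\Sigma^*_{jj}$ and $\lambda_{\min},\lambda_{\max}$ are extreme eigenvalues. $M,\varepsilon_1,\varepsilon_2$ are treated as constants. Assumption 2: $\mathrm w:\mathbb R\to\mathbb R$ is nonincreasing, $0\le\mathrm w(t)\le1$ for $t\ge0$, $\mathrm w(t)=1$ for $t\le0$; there is a constant $\alpha$ with $\mathrm w(\alpha\lambda)=0$; and $\mathrm w(u)\ge1/2$. Assumption 3: $\min_{(i,j)\in S}|\Psi^*_{ij}|\ge(\alpha+c)\lambda$. Asymptotic conventions. $f\gtrsim g$ (resp. $f\lesssim g$) means $f\ge kg$ (resp. $f\le kg$) for a positive constant $k$; $f\asymp g$ means both. Constants do not depend on $n,d,s$ (they may depend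 on $M,\varepsilon_1,\varepsilon_2,\alpha$), and in sample size conditions and in lower bounds on $T$ the constant is sufficiently large. $Y_n=\mathcal O_{\mathbb P}(a_n)$ means $Y_n/a_n$ is bounded in probability as $n,d\to\infty$, where $d,s$ may grow with $n$. *)

(* Defs.v *)
From HB Require Import structures.
From mathcomp Require Import all_boot all_order all_algebra.
From mathcomp Require Import all_classical all_reals all_analysis.

Set Implicit Arguments.
Unset Strict Implicit.
Unset Printing Implicit Defensive.

Import Order.TTheory GRing.Theory Num.Theory.
Import numFieldNormedType.Exports.

Local Open Scope classical_set_scope.
Local Open Scope ring_scope.

Section MatrixNotions.
Context {R : realType}.

Definition frobenius_norm m n (A : 'M[R]_(m, n)) : R :=
  Num.sqrt (\sum_i \sum_j A i j ^+ 2).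

(* On column vectors [frobenius_norm] is the Euclidean norm. *)
Definition spectral_norm m n (A : 'M[R]_(m, n)) : R :=
  sup [set frobenius_norm (A *m x) |
       x in [set x : 'cV[R]_n | frobenius_norm x <= 1]].

Definition infinity_norm m n (A : 'M[R]_(m, n)) : R :=
  \big[Num.max/0]_i \sum_j `|A i j|.

Definition inner_mx m n (A B : 'M[R]_(m, n)) : R := \tr (A^T *m B).

Definition hadamard m n (A B : 'M[R]_(m, n)) : 'M[R]_(m, n) :=
  map2_mx *%R A B.

Definition off_norm1 d (A : 'M[R]_d) : R :=
  \sum_i \sum_(j | i != j) `|A i j|.

Definition restrict_mx d (E : {set 'I_d * 'I_d}) (A : 'M[R]_d) : 'M[R]_d :=
  \matrix_(i, j) if (i, j) \in E then A i j else 0.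

Definition off_support d (A : 'M[R]_d) : {set 'I_d * 'I_d} :=
  [set p | (p.1 != p.2) && (A p.1 p.2 != 0)].

Definition posdef d : set 'M[R]_d :=
  [set A | A^T = A /\ forall x : 'cV[R]_d, x != 0 -> 0 < (x^T *m A *m x) 0 0].

Definition lambda_min d (A : 'M[R]_d) : R := inf [set a | eigenvalue A a].
Definition lambda_max d (A : 'M[R]_d) : R := sup [set a | eigenvalue A a].

Definition sigma_min d (Sigma : 'M[R]_d) : R :=
  Num.sqrt (inf (range (fun j => Sigma j j))).
Definition sigma_max d (Sigma : 'M[R]_d) : R :=
  Num.sqrt (sup (range (fun j => Sigma j j))).

Definition std_diag d (Sigma : 'M[R]_d) : 'M[R]_d :=
  diag_mx (\row_j Num.sqrt (Sigma j j)).

Definition correlation d (Sigma : 'M[R]_d) : 'M[R]_d :=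
  invmx (std_diag Sigma) *m Sigma *m invmx (std_diag Sigma).

Definition precision d (Sigma : 'M[R]_d) : 'M[R]_d := invmx Sigma.

Definition inv_correlation d (Sigma : 'M[R]_d) : 'M[R]_d :=
  invmx (correlation Sigma).

Definition gradient d (f : 'M[R]_d -> R) (A : 'M[R]_d) : 'M[R]_d :=
  \matrix_(i, j) 'D_(delta_mx i j) (f : 'M[R]_d -> R^o) A.

Definition is_argmin (T : Type) (D : set T) (f : T -> R) : set T :=
  [set x | D x /\ forall y, D y -> f x <= f y].

End MatrixNotions.

Section Estimators.
Context {R : realType}.

Definition sample_cov n d (x : 'I_n -> d.-tuple R) : 'M[R]_d :=
  n%:R^-1 *: \sum_i ((\col_j tnth (x i) j) *m (\row_j tnth (x i) j)).

Definition loss d (Chat Psi : 'M[R]_d) : R :=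
  inner_mx Psi Chat - ln (\det Psi).

Definition penalized_loss d (Chat Lambda Psi : 'M[R]_d) : R :=
  loss Chat Psi + off_norm1 (hadamard Lambda Psi).

(* The diagonal entries are irrelevant, since [off_norm1] ignores them. *)
Definition weights d (w : R -> R) (lambda : R) (Psi : 'M[R]_d) : 'M[R]_d :=
  \matrix_(i, j) (lambda * w `|Psi i j|).

(* [adaptive_est w lambda Chat l] is the l-th estimator; when the minimization
   problem has no solution it takes the junk value 0 (see [est_is_argmin]). *)
Fixpoint adaptive_est d (w : R -> R) (lambda : R) (Chat : 'M[R]_d) (l : nat)
    : 'M[R]_d :=
  if l is l'.+1 then
    xget 0 (is_argmin (@posdef R d)
      (penalized_loss Chat (weights w lambda (adaptive_est w lambda Chat l'))))
  else 0.

Definition est_is_argmin d (w : R -> R) (lambda : R) (Chat : 'M[R]_d)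
    (l : nat) : Prop :=
  is_argmin (@posdef R d)
    (penalized_loss Chat (weights w lambda (adaptive_est w lambda Chat l.-1)))
    (adaptive_est w lambda Chat l).

End Estimators.

Section Assumptions.
Context {R : realType}.

Definition c_const d (Sigma : 'M[R]_d) : R :=
  2 * (32 * spectral_norm (inv_correlation Sigma) ^+ 2
       + Num.max (infinity_norm Sigma ^+ 2) 1).

Definition assumption1 (M eps1 eps2 : R) (s d : nat) (Sigma : 'M[R]_d) : Prop :=
  [/\ (#|off_support (precision Sigma)| <= s)%N,
      infinity_norm Sigma <= M,
      eps1 <= sigma_min Sigma <= sigma_max Sigma /\ sigma_max Sigma <= eps1^-1
    & eps2 <= lambda_min (precision Sigma) <= lambda_max (precision Sigma) /\
      lambda_max (precision Sigma) <= eps2^-1].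

Definition assumption2 (alpha lambda : R) (w : R -> R) (d : nat)
    (Sigma : 'M[R]_d) : Prop :=
  [/\ {homo w : x y / x <= y >-> y <= x},
      forall t, 0 <= t -> 0 <= w t <= 1,
      forall t, t <= 0 -> w t = 1,
      w (alpha * lambda) = 0
    & 2^-1 <= w (c_const Sigma * lambda)].

Definition assumption3 (alpha lambda : R) (d : nat) (Sigma : 'M[R]_d) : Prop :=
  forall i j, (i, j) \in off_support (precision Sigma) ->
    (alpha + c_const Sigma) * lambda <= `|inv_correlation Sigma i j|.

End Assumptions.

Section Probability.
Context {R : realType} {disp : measure_display} {Omega : measurableType disp}.
Variable P : probability Omega R.

(* The event need not be known to be measurable. *)
Definition with_prob_ge (p : R) (E : set Omega) : Prop :=
  exists A : set Omega, [/\ measurable A, A `<=` E & (p%:E <= P A)%E].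

(* Cramer-Wold definition of N(0, Sigma) for positive definite Sigma; a = 0 is
   left out because [normal_prob 0 0] is not the Dirac mass at 0. *)
Definition gaussian_rv d (Sigma : 'M[R]_d) (X : {RV P >-> d.-tuple R}) : Prop :=
  forall a : 'cV[R]_d, a != 0 ->
  forall B : set R, measurable B ->
    P [set omega | B (\sum_j a j 0 * tnth (X omega) j)] =
    normal_prob 0 (Num.sqrt ((a^T *m Sigma *m a) 0 0)) B.

Definition mutually_independent n d (X : 'I_n -> {RV P >-> d.-tuple R}) : Prop :=
  forall B : 'I_n -> set (d.-tuple R), (forall i, measurable (B i)) ->
    P (\bigcap_i (X i @^-1` B i)) = (\prod_i P (X i @^-1` B i))%E.

Definition iid_gaussian n d (Sigma : 'M[R]_d)
    (X : 'I_n -> {RV P >-> d.-tuple R}) : Prop :=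
  mutually_independent X /\ forall i, gaussian_rv Sigma (X i).

Definition sample_corr n d (X : 'I_n -> {RV P >-> d.-tuple R}) (omega : Omega)
    : 'M[R]_d :=
  correlation (sample_cov (fun i => X i omega)).

End Probability.

Definition bounded_in_prob {R : realType} {disp : nat -> measure_display}
    {Omega : forall n, measurableType (disp n)}
    (P : forall n, probability (Omega n) R)
    (Y : forall n, Omega n -> R) (a : nat -> R) : Prop :=
  forall eps : R, 0 < eps -> exists2 K : R, 0 < K &
    \forall n \near \oo,
      with_prob_ge (P n) (1 - eps) [set omega | `|Y n omega| <= K * a n].

Definition rate {R : realType} (n d : nat) : R := Num.sqrt (ln d%:R / n%:R).

(* Conditions common to both conclusions. [C], [A] and [B] are the constants of
   [n >~ s log d] and of [lambda =~ sqrt (log d / n)]. *)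
Definition setting {R : realType} (M eps1 eps2 alpha A B C : R) (n d s : nat)
    (Sigma : 'M[R]_d) (lambda : R) (w : R -> R)
    (disp : measure_display) (Omega : measurableType disp)
    (P : probability Omega R) (X : 'I_n -> {RV P >-> d.-tuple R}) : Prop :=
  [/\ [/\ (0 < n)%N, (0 < d)%N, posdef Sigma & iid_gaussian Sigma X],
      [/\ assumption1 M eps1 eps2 s Sigma,
          assumption2 alpha lambda w Sigma
        & assumption3 alpha lambda Sigma],
      C * (s%:R * ln d%:R) <= n%:R,
      0 < lambda
    & A * rate n d <= lambda <= B * rate n d].

(* Main.v *)
Require Import Defs.
From mathcomp Require Import all_boot all_order all_algebra.
From mathcomp Require Import all_classical all_reals all_analysis.
From mathcomp Require Import measurable_realfun ring lra.

(** Write [G = Chat - C*] and [D = Psi - Psi*].  The Bregman divergence of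
    [- ln \det] at [Psi*] is at least [|D|_F^2 / (8 |Psi*|_2^2)] on a fixed small
    Frobenius ball.  If [|G_ij| <= lambda / 4] everywhere, the entries off the
    support whose weight is at least 1/2 can only increase the penalized loss; the
    other entries off the support number at most [s], and, like the
    penalty on the support, they cost at most a small multiple of the error of the
    previous estimator, because their weights deviate from the ideal ones only
    where that error exceeds [c * lambda].  Hence the penalized loss exceeds its
    value at [Psi*] on the ball outside a smaller radius, and convexity turns this
    into existence and localization of its minimizers.

    The bound on [G] comes from a Chernoff bound for Gaussian quadratic forms and
    polarization.  In the regime [n < 384 ln d] the bound is trivial, since the
    entries of correlation matrices are at most 1 and [lambda >= 8]; there the
    sample size condition also forces [s = 0].  The same exponential moments give
    [E |G_S|_F^2 = O(s / n)], and iterating the contraction gives the rate. *)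

Set Implicit Arguments.
Unset Strict Implicit.
Unset Printing Implicit Defensive.

Import Order.TTheory GRing.Theory Num.Theory.
Import numFieldNormedType.Exports.

Local Open Scope classical_set_scope.
Local Open Scope ring_scope.

(** * Matrix inequalities *)

Section LinearAlgebra.
Context {R : realType}.

(** The count of small weights off the support is an invariant of the iteration. Write [p] for the
    spectral norm of Psi*. A weight below 1/2 off the support forces an error of at least
    [c * lambda] in that entry, while every minimizer lies within [16 * p ^+ 2 * lambda * sqrt s] of
    Psi*; since [64 * p ^+ 2 <= c], at most [s] such entries exist at the next step. The invariant
    starts for free, because the initial estimator 0 has all weights [w 0 = 1].

    All constants must be uniform in [n], [d] and [s]. The least eigenvalue of Psi* is controlled by
    the row sums of the correlation matrix, and [p] by [alpha]: Assumption 2 forces [c <= alpha].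

    Existence of the minimizers has to be proved along with the bounds, since an estimator without
    minimizer would take a default value. The error of the initial estimator is the norm of Psi*,
    which may grow with [d]; the rate therefore iterates the contraction from the first estimator
    on, whose error is already of order [lambda * sqrt s]. *)

Lemma sum_cauchy_schwarz (I : finType) (P : pred I) (a b : I -> R) :
  \sum_(i | P i) a i * b i <=
  Num.sqrt (\sum_(i | P i) a i ^+ 2) * Num.sqrt (\sum_(i | P i) b i ^+ 2).
Proof.
set C := \sum_(i | P i) a i * b i.
set A := \sum_(i | P i) a i ^+ 2; set B := \sum_(i | P i) b i ^+ 2.
have A0 : 0 <= A by apply: sumr_ge0 => i _; exact: sqr_ge0.
have B0 : 0 <= B by apply: sumr_ge0 => i _; exact: sqr_ge0.
(* The expanded square avoids dividing by [B]; if [B = 0], all [b i] vanish and the claim is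
   immediate. *)
have key : 0 <= B * (A * B - C ^+ 2).
  have -> : B * (A * B - C ^+ 2) = \sum_(i | P i) (B * a i - C * b i) ^+ 2.
    transitivity (B ^+ 2 * A - 2 * B * C * C + C ^+ 2 * B); first by ring.
    transitivity (\sum_(i | P i) (B ^+ 2 * a i ^+ 2 - 2 * B * C * (a i * b i)
                    + C ^+ 2 * b i ^+ 2)).
      by rewrite big_split sumrB /= -!mulr_sumr.
    by apply: eq_bigr => i _; ring.
  by apply: sumr_ge0 => i _; exact: sqr_ge0.
rewrite -sqrtrM//; apply: le_trans (ler_norm _) _; rewrite -sqrtr_sqr ler_wsqrtr//.
have [B0'|Bn0] := eqVneq B 0; last first.
  by rewrite -subr_ge0 -(pmulr_rge0 _ (_ : 0 < B))// lt0r Bn0.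
have b0 i : P i -> b i = 0.
  move=> Pi; apply/eqP; rewrite -sqrf_eq0; apply/eqP.
  by apply: (psumr_eq0P _ B0') => // j _; exact: sqr_ge0.
by rewrite /C big1 ?expr0n ?mulr_ge0// => i Pi; rewrite b0// mulr0.
Qed.

Lemma norm_sum_cauchy_schwarz (I : finType) (P : pred I) (a b : I -> R) :
  `|\sum_(i | P i) a i * b i| <=
  Num.sqrt (\sum_(i | P i) a i ^+ 2) * Num.sqrt (\sum_(i | P i) b i ^+ 2).
Proof.
rewrite ler_norml lerNl -sumrN; apply/andP; split; last exact: sum_cauchy_schwarz.
have := sum_cauchy_schwarz P (fun i => - a i) b.
under [X in X <= _]eq_bigr do rewrite mulNr.
by under [X in Num.sqrt X * _]eq_bigr do rewrite sqrrN.
Qed.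

Lemma inner_mxE m n (A B : 'M[R]_(m, n)) :
  inner_mx A B = \sum_(p : 'I_m * 'I_n) A p.1 p.2 * B p.1 p.2.
Proof.
rewrite /inner_mx /mxtrace -(pair_bigA _ (fun i j => A i j * B i j)) exchange_big /=.
by apply: eq_bigr => j _; rewrite mxE; apply: eq_bigr => i _; rewrite mxE.
Qed.

Lemma frobenius_normE m n (A : 'M[R]_(m, n)) :
  frobenius_norm A = Num.sqrt (\sum_(p : 'I_m * 'I_n) A p.1 p.2 ^+ 2).
Proof. by rewrite /frobenius_norm (pair_bigA _ (fun i j => A i j ^+ 2)). Qed.

Lemma frobenius_norm_ge0 m n (A : 'M[R]_(m, n)) : 0 <= frobenius_norm A.
Proof. exact: sqrtr_ge0. Qed.

Lemma frobenius_sqr m n (A : 'M[R]_(m, n)) :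
  frobenius_norm A ^+ 2 = inner_mx A A.
Proof.
rewrite frobenius_normE sqr_sqrtr; last by apply: sumr_ge0 => i _; exact: sqr_ge0.
by rewrite inner_mxE; apply: eq_bigr => p _; rewrite expr2.
Qed.

Lemma inner_mx_le m n (A B : 'M[R]_(m, n)) :
  inner_mx A B <= frobenius_norm A * frobenius_norm B.
Proof. by rewrite inner_mxE !frobenius_normE; exact: sum_cauchy_schwarz. Qed.

Lemma frobenius_normZ m n a (A : 'M[R]_(m, n)) :
  frobenius_norm (a *: A) = `|a| * frobenius_norm A.
Proof.
rewrite !frobenius_normE -sqrtr_sqr -sqrtrM ?sqr_ge0// mulr_sumr.
by congr Num.sqrt; apply: eq_bigr => p _; rewrite mxE exprMn.
Qed.

Lemma frobenius_norm_eq0 m n (A : 'M[R]_(m, n)) :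
  frobenius_norm A = 0 -> A = 0.
Proof.
move=> A0; have : inner_mx A A = 0 by rewrite -frobenius_sqr A0 expr0n.
rewrite inner_mxE => /psumr_eq0P A00; apply/matrixP => i j; rewrite mxE.
apply/eqP; rewrite -sqrf_eq0 expr2; apply/eqP.
by apply: (A00 _ (i, j)) => // p _; rewrite -expr2 sqr_ge0.
Qed.

Lemma frobenius_norm_entry m n (A : 'M[R]_(m, n)) i j :
  `|A i j| <= frobenius_norm A.
Proof.
rewrite frobenius_normE -sqrtr_sqr ler_wsqrtr// (bigD1 (i, j))//= lerDl.
by apply: sumr_ge0 => p _; exact: sqr_ge0.
Qed.

Definition qf n (A : 'M[R]_n) (x : 'cV[R]_n) : R := (x^T *m A *m x) 0 0.

Lemma qfE n (A : 'M[R]_n) x : qf A x = inner_mx x (A *m x).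
Proof. by rewrite /qf /inner_mx /mxtrace big_ord1 mulmxA. Qed.

Lemma qfD n (A B : 'M[R]_n) x : qf (A + B) x = qf A x + qf B x.
Proof. by rewrite /qf mulmxDr mulmxDl mxE. Qed.

Lemma qfZ n a (A : 'M[R]_n) x : qf (a *: A) x = a * qf A x.
Proof. by rewrite /qf -scalemxAr -scalemxAl mxE. Qed.

Lemma qf_congr m n (A : 'M[R]_n) (B : 'M[R]_(n, m)) x :
  qf (B^T *m A *m B) x = qf A (B *m x).
Proof. by rewrite /qf trmx_mul !mulmxA. Qed.

Lemma posdef_qf_ge0 n (A : 'M[R]_n) x : posdef A -> 0 <= qf A x.
Proof.
move=> [_ Ap]; have [->|x0] := eqVneq x 0; last exact/ltW/Ap.
by rewrite /qf mulmx0 mxE.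
Qed.

Lemma posdef_congr n (A B : 'M[R]_n) :
  posdef A -> B \in unitmx -> posdef (B^T *m A *m B).
Proof.
move=> [At Ap] Bu; split; first by rewrite !trmx_mul trmxK At mulmxA.
move=> x x0; rewrite -[X in 0 < X]/(qf _ _) qf_congr; apply: Ap.
by apply: contra_neq x0 => Bx0; rewrite -(mulKmx Bu x) Bx0 mulmx0.
Qed.

Lemma posdef_unit n (A : 'M[R]_n) : posdef A -> A \in unitmx.
Proof.
move=> [At Ap]; rewrite -row_free_unit -kermx_eq0; apply/eqP.
apply/row_matrixP => i; rewrite row0; set v := row i _.
have vA : v *m A = 0 by rewrite /v -row_mul mulmx_ker row0.
apply: contrapT => /eqP v0; have := Ap v^T.
by rewrite trmxK vA mul0mx mxE ltxx trmx_eq0 => /(_ v0).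
Qed.

Lemma posdef_inv n (A : 'M[R]_n) : posdef A -> posdef (invmx A).
Proof.
move=> Ap; have Au := posdef_unit Ap.
have -> : invmx A = (invmx A)^T *m A *m invmx A.
  by rewrite trmx_inv Ap.1 mulVmx// mul1mx.
by apply: posdef_congr => //; rewrite unitmx_inv.
Qed.

Lemma posdef_conv n (A B : 'M[R]_n) t : posdef A -> posdef B -> 0 <= t <= 1 ->
  posdef ((1 - t) *: A + t *: B).
Proof.
move=> [At Ap] [Bt Bp] /andP[t0 t1]; split.
  by rewrite linearD /= !linearZ /= At Bt.
move=> x x0; rewrite -[X in 0 < X]/(qf _ _) qfD !qfZ.
have := Ap x x0; have := Bp x x0; rewrite -!/(qf _ _).
by move: (qf _ _) (qf _ _) => a b; nra.
Qed.

(** Induction on the Schur complement of the top left entry. The factor replaces a spectral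
    decomposition below: it yields the determinant as a product and serves as a square root. *)
Lemma cholesky n (A : 'M[R]_n) : posdef A ->
  exists L : 'M[R]_n, [/\ is_trig_mx L, forall i, 0 < L i i & A = L *m L^T].
Proof.
elim: n A => [|n IH] A Apd.
  exists 0; split; [exact: mx0_is_trig | by case | by rewrite flatmx0 [RHS]flatmx0].
move: A Apd; rewrite -[n.+1]/(1 + n)%N => A [At Ap].
set a := A 0 0; set b := dlsubmx A; set D := drsubmx A.
have a_gt0 : 0 < a.
  have := Ap (delta_mx 0 0); rewrite trmx_delta -rowE -colE !mxE; apply.
  by apply/eqP => /matrixP/(_ 0 0); rewrite !mxE eqxx => /eqP; rewrite oner_eq0.
have AE : A = block_mx a%:M b^T b D.
  rewrite -[LHS]submxK; congr block_mx.
    by rewrite [LHS]mx11_scalar !mxE; congr (A _ _)%:M; apply/val_inj.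
  by rewrite /b trmx_dlsub At.
have sa : a = Num.sqrt a ^+ 2 by rewrite sqr_sqrtr// ltW.
pose r := Num.sqrt a.
have r0 : 0 < r by rewrite sqrtr_gt0.
have Dt : D^T = D by rewrite /D trmx_drsub At.
pose S := D - a^-1 *: (b *m b^T).
have Spd : posdef S.
  split; first by rewrite linearB linearZ /= trmx_mul trmxK Dt.
  move=> x x0.
  (* Completing the square: with this first coordinate the form of [A] at [y] equals that of [S] at
     [x]. *)
  pose y : 'cV[R]_(1 + n) := col_mx (- a^-1 *: (b^T *m x)) x.
  have y0 : y != 0.
    by rewrite col_mx_eq0 (negbTE x0) andbF.
  have := Ap y y0; rewrite [X in _ *m X *m _]AE -mulmxA mul_block_col tr_col_mx mul_row_col.
  rewrite !mul_scalar_mx scalerA mulrN divff ?gt_eqF// scaleN1r addNr mulmx0 add0r.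
  by rewrite -scalemxAr mulmxDr /S mulmxBr mulmxBl -!(scalemxAr, scalemxAl) !mulmxA addrC scaleNr.
have [L' [L't L'p SE]] := IH S Spd.
exists (block_mx r%:M 0 (r^-1 *: b) L'); split.
- rewrite is_trig_block_mx// eqxx L't andbT /=; exact: scalar_mx_is_trig.
- move=> i; rewrite -(splitK i); case: (fintype.split i) => j; rewrite /unsplit.
    by rewrite block_mxEul mxE ord1 eqxx.
  by rewrite block_mxEdr.
- rewrite AE tr_block_mx tr_scalar_mx trmx0 linearZ /= mulmx_block.
  rewrite !mulmx0 !mul0mx !addr0 -scalar_mxM -expr2 -sa.
  rewrite mul_scalar_mx scalerA divff ?gt_eqF// scale1r.
  rewrite mul_mx_scalar scalerA divff ?gt_eqF// scale1r.
  rewrite -SE /S -scalemxAr -scalemxAl scalerA -invfM -expr2 -sa.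
  by rewrite [_ + (D - _)]addrC subrK.
Qed.

Lemma posdef_det_gt0 n (A : 'M[R]_n) : posdef A -> 0 < \det A.
Proof.
move=> /cholesky[L [Lt Lp ->]]; rewrite det_mulmx det_tr -expr2 exprn_gt0//.
by rewrite det_trig//; apply: prodr_gt0 => i _.
Qed.

Lemma ln_le_subr1 (x : R) : 0 < x -> ln x <= x - 1.
Proof. by move=> x0; have := expR_ge1Dx (ln x); rewrite lnK ?posrE//; lra. Qed.

Lemma ln_prod (I : finType) (F : I -> R) : (forall i, 0 < F i) ->
  ln (\prod_i F i) = \sum_i ln (F i).
Proof.
move=> F0; suff [] : 0 < \prod_i F i /\ ln (\prod_i F i) = \sum_i ln (F i) by [].
elim/big_ind2 : _ => [|x1 x2 y1 y2 [x0 xE] [y0 yE]|//]; first by rewrite ln1.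
by rewrite mulr_gt0// lnM ?posrE// xE yE.
Qed.

(** The determinant only sees the diagonal of the Cholesky factor, where [ln x <= x - 1] applies;
    the trace is the sum of the squares of all its entries. *)
Lemma ln_det_le_trace n (A : 'M[R]_n) : posdef A ->
  ln (\det A) <= \tr A - n%:R.
Proof.
move=> /cholesky[L [Lt Lp ->]]; rewrite det_mulmx det_tr -expr2 det_trig//.
rewrite -prodrXl ln_prod => [|i]; last by rewrite exprn_gt0.
apply: (@le_trans _ _ (\sum_i (L i i ^+ 2 - 1))).
  by apply: ler_sum => i _; rewrite ln_le_subr1// exprn_gt0.
rewrite sumrB sumr_const card_ord lerD2r /mxtrace.
apply: ler_sum => i _; rewrite mxE (bigD1 i)//= mxE -expr2 lerDl.
by apply: sumr_ge0 => j _; rewrite mxE -expr2 sqr_ge0.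
Qed.

(** Whitening by the Cholesky factor of [V] reduces the tangent at [V] to the tangent at the
    identity. *)
Lemma ln_det_tangent n (A V : 'M[R]_n) : posdef A -> posdef V ->
  ln (\det A) <= ln (\det V) + \tr (invmx V *m (A - V)).
Proof.
move=> Ap Vp; have Vu := posdef_unit Vp; have [L [Lt Lp VE]] := cholesky Vp.
have Lu : L \in unitmx by move: Vu; rewrite VE unitmx_mul => /andP[].
have LTu : L^T \in unitmx by rewrite unitmx_tr.
have Bp : posdef ((invmx L^T)^T *m A *m invmx L^T).
  by apply: posdef_congr; rewrite ?unitmx_inv.
have := ln_det_le_trace Bp.
rewrite trmx_inv trmxK !det_mulmx !det_inv det_tr -mulmxA mxtrace_mulC -mulmxA.
have -> : invmx L^T *m invmx L = invmx V.
  apply: (can_inj (mulKmx Vu)); rewrite (mulmxV Vu) mulmxA [in V *m _]VE.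
  by rewrite (mulmxK LTu) mulmxV.
have -> : (\det L)^-1 * \det A * (\det L)^-1 = \det A * (\det V)^-1.
  by rewrite VE det_mulmx det_tr invfM; ring.
have dA := posdef_det_gt0 Ap; have dV := posdef_det_gt0 Vp.
rewrite lnM ?posrE ?invr_gt0// lnV ?posrE//.
rewrite mulmxBr (mulVmx Vu) raddfB /= mxtrace1 (mxtrace_mulC (invmx V)).
by lra.
Qed.

(** Both tangents are taken at the mixture, where the weighted trace terms cancel. *)
Lemma ln_det_concave n (A B : 'M[R]_n) t : posdef A -> posdef B -> 0 <= t <= 1 ->
  (1 - t) * ln (\det A) + t * ln (\det B) <= ln (\det ((1 - t) *: A + t *: B)).
Proof.
move=> Ap Bp t01; set V := (1 - t) *: A + t *: B; have Vp : posdef V by exact: posdef_conv.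
have hA := ln_det_tangent Ap Vp; have hB := ln_det_tangent Bp Vp.
have : (1 - t) * \tr (invmx V *m (A - V)) + t * \tr (invmx V *m (B - V)) = 0.
  rewrite -!mxtraceZ -mxtraceD !scalemxAr -mulmxDr.
  rewrite !scalerBr addrACA -opprD -[X in _ - X]scalerDl subrK scale1r subrr.
  by rewrite mulmx0 mxtrace0.
move: t01 hA hB; move: (ln _) (ln _) (ln _) (\tr _) (\tr _) => a b v x y.
by move=> /andP[t0 t1] hA hB xy; nra.
Qed.

(** Nonnegativity of the form of [P] at [invmx P *m y - p^-1 *: y] gives the bound without
    eigenvalues. *)
Lemma qf_inv_ge n (P : 'M[R]_n) p y : 0 < p -> posdef P ->
  (forall x, qf P x <= p * frobenius_norm x ^+ 2) ->
  frobenius_norm y ^+ 2 <= p * qf (invmx P) y.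
Proof.
move=> p0 Pp Pb; have Pu := posdef_unit Pp.
pose x := invmx P *m y; have yE : y = P *m x by rewrite mulKVmx.
have -> : qf (invmx P) y = qf P x.
  by rewrite -qf_congr trmx_inv Pp.1 mulVmx// mul1mx.
have := posdef_qf_ge0 (x - p^-1 *: y) Pp.
have -> : qf P (x - p^-1 *: y) =
    qf P x - 2 * p^-1 * frobenius_norm y ^+ 2 + p^-1 ^+ 2 * qf P y.
  rewrite frobenius_sqr !qfE mulmxBr -yE -scalemxAr /inner_mx.
  have -> : (x - p^-1 *: y)^T = x^T - p^-1 *: y^T by rewrite linearB linearZ.
  rewrite mulmxBl !mulmxBr -!(scalemxAl, scalemxAr).
  have -> : x^T *m (P *m y) = y^T *m y 
    by have -> : y^T = x^T *m P by [rewrite yE trmx_mul Pp.1]; rewrite mulmxA.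
  rewrite !raddfB /= !mxtraceZ.
  by move: (\tr _) (\tr _) (\tr _) => a b c; ring.
have := Pb y; move: (qf P y) (qf P x) (frobenius_norm y ^+ 2) => a b v ha hb.
rewrite -subr_ge0 -(pmulr_rge0 _ (_ : 0 < p^-1)) ?invr_gt0//.
rewrite mulrBr mulKf ?gt_eqF//.
apply: le_trans hb _.
have : p^-1 ^+ 2 * a <= p^-1 * v.
  by rewrite expr2 -mulrA ler_wpM2l ?invr_ge0 ?(ltW p0)// ler_pdivrMl.
lra.
Qed.

Lemma mxtrace_congr_ge m n (K : 'M[R]_n) k (D : 'M[R]_(n, m)) :
  (forall x, k * frobenius_norm x ^+ 2 <= qf K x) ->
  k * frobenius_norm D ^+ 2 <= \tr (D^T *m K *m D).
Proof.
move=> Kk; rewrite frobenius_sqr /inner_mx /mxtrace mulr_sumr.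
apply: ler_sum => j _.
have -> : (D^T *m D) j j = frobenius_norm (col j D) ^+ 2.
  rewrite frobenius_sqr /inner_mx /mxtrace big_ord1 !mxE.
  by apply: eq_bigr => i _; rewrite !mxE.
have -> : (D^T *m K *m D) j j = qf K (col j D).
  rewrite /qf -mulmxA -[RHS]/((_ *m K *m _) 0 0) -[in RHS]mulmxA.
  rewrite [LHS]mxE [RHS]mxE; apply: eq_bigr => i _; rewrite !mxE; congr (_ * _).
  by apply: eq_bigr => k' _; rewrite !mxE.
exact: Kk.
Qed.

(** Factoring the inverse of [Q] as [L *m L^T] turns the trace into that of
    [(D *m L)^T *m invmx P *m (D *m L)]; the lower bounds 1/p and 1/q on the two inverse forms then
    apply one after the other. *)
Lemma mxtrace_inv_ge n (P Q D : 'M[R]_n) p q : 0 < p -> 0 < q ->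
  posdef P -> posdef Q -> D^T = D ->
  (forall x, qf P x <= p * frobenius_norm x ^+ 2) ->
  (forall x, qf Q x <= q * frobenius_norm x ^+ 2) ->
  frobenius_norm D ^+ 2 / (p * q) <= \tr (invmx P *m D *m invmx Q *m D).
Proof.
move=> p0 q0 Pp Qp Dt Pb Qb; have [L [_ _ LE]] := cholesky (posdef_inv Qp).
have kP x : p^-1 * frobenius_norm x ^+ 2 <= qf (invmx P) x.
  by rewrite ler_pdivrMl//; exact: qf_inv_ge.
have kQ x : q^-1 * frobenius_norm x ^+ 2 <= qf (invmx Q) x.
  by rewrite ler_pdivrMl//; exact: qf_inv_ge.
have -> : \tr (invmx P *m D *m invmx Q *m D) =
    \tr ((D *m L)^T *m invmx P *m (D *m L)).
  rewrite LE trmx_mul Dt !mulmxA mxtrace_mulC !mulmxA mxtrace_mulC !mulmxA.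
  by rewrite mxtrace_mulC !mulmxA.
apply: le_trans (mxtrace_congr_ge (D *m L) kP).
rewrite invfM mulrC -mulrA ler_wpM2l ?invr_ge0 ?(ltW p0)//.
apply: le_trans (mxtrace_congr_ge D kQ) _.
rewrite frobenius_sqr /inner_mx trmx_mul Dt LE -!mulmxA [leRHS]mxtrace_mulC.
by rewrite -!mulmxA [leRHS]mxtrace_mulC -!mulmxA.
Qed.

(* Two tangent steps, at [P] and at the midpoint, already give the quadratic
   lower bound: no second derivative of [ln \det] is needed. *)
Lemma bregman_ln_det_ge n (P D : 'M[R]_n) p q : 0 < p -> 0 < q ->
  posdef P -> posdef (P + D) ->
  (forall x, qf P x <= p * frobenius_norm x ^+ 2) ->
  (forall x, qf (P + 2^-1 *: D) x <= q * frobenius_norm x ^+ 2) ->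
  frobenius_norm D ^+ 2 / (4 * (p * q)) <=
  ln (\det P) - ln (\det (P + D)) + \tr (invmx P *m D).
Proof.
move=> p0 q0 Pp PDp Pb Qb; set Q := P + 2^-1 *: D in Qb *.
have Qp : posdef Q.
  have -> : Q = (1 - 2^-1) *: P + 2^-1 *: (P + D).
    by rewrite /Q scalerDr addrA -scalerDl subrK scale1r.
  by apply: posdef_conv => //; lra.
have Dt : D^T = D by have := PDp.1; rewrite linearD /= Pp.1 => /addrI.
have Pu := posdef_unit Pp; have Qu := posdef_unit Qp.
have h1 := ln_det_tangent PDp Qp; have h2 := ln_det_tangent Qp Pp.
have h3 := mxtrace_inv_ge p0 q0 Pp Qp Dt Pb Qb.
have QP : Q - P = 2^-1 *: D by rewrite /Q addrC addKr.
have DQ : P + D - Q = 2^-1 *: D.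
  rewrite /Q opprD addrACA subrr add0r -[X in X - _]scale1r -scalerBl.
  by congr (_ *: _); lra.
(* Resolvent identity with [Q - P = D / 2]: the change of slope between the two tangent points is
   the quadratic term bounded by [h3], and a quarter of it survives in the conclusion. *)
have PQ : invmx P *m D *m invmx Q *m D = 2 *: (invmx P *m D - invmx Q *m D).
  rewrite -mulmxBl.
  have -> : invmx P - invmx Q = invmx P *m (Q - P) *m invmx Q.
    by rewrite mulmxBr mulVmx// mulmxBl mul1mx mulmxK.
  rewrite QP -scalemxAr -!scalemxAl scalerA divff ?scale1r//.
rewrite PQ mxtraceZ linearB /= in h3.
rewrite DQ -scalemxAr mxtraceZ in h1; rewrite QP -scalemxAr mxtraceZ in h2.
move: h1 h2 h3; rewrite [(4 * _)^-1]invfM mulrCA.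
move: (ln _) (ln _) (ln _) (\tr _) (\tr _) (_ / _) => a b c x y z; lra.
Qed.

End LinearAlgebra.

(** * Existence and localization of the minimizer *)

Section PenalizedLoss.
Context {R : realType}.

Lemma cvg_big_sum {T : Type} {G : set_system T} {FG : Filter G} (I : finType)
    (P : pred I) (F : I -> T -> R) (l : I -> R) :
  (forall i, P i -> F i x @[x --> G] --> l i) ->
  \sum_(i | P i) F i x @[x --> G] --> \sum_(i | P i) l i.
Proof.
move=> cF; elim: (index_enum I) => [|i r IH].
  by rewrite big_nil; under eq_fun do rewrite big_nil; exact: cvg_cst.
rewrite big_cons; under eq_fun do rewrite big_cons; case: ifPn => // Pi.
by apply: cvgD => //; exact: cF.
Qed.

Lemma cvg_big_prod {T : Type} {G : set_system T} {FG : Filter G} (I : finType)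
    (P : pred I) (F : I -> T -> R) (l : I -> R) :
  (forall i, P i -> F i x @[x --> G] --> l i) ->
  \prod_(i | P i) F i x @[x --> G] --> \prod_(i | P i) l i.
Proof.
move=> cF; elim: (index_enum I) => [|i r IH].
  by rewrite big_nil; under eq_fun do rewrite big_nil; exact: cvg_cst.
rewrite big_cons; under eq_fun do rewrite big_cons; case: ifPn => // Pi.
by apply: cvgM => //; exact: cF.
Qed.

Lemma continuous_vec_mx_entry m n i j :
  continuous (fun v : 'rV[R]_(m * n) => vec_mx v i j).
Proof. by under eq_fun do rewrite mxE; exact: coord_continuous. Qed.

Lemma continuous_det_vec_mx n :
  continuous (fun v : 'rV[R]_(n * n) => \det (vec_mx v : 'M[R]_n)).
Proof.
move=> v; apply: (@cvg_big_sum _ (nbhs v)) => s _; apply: (@cvgM _ _ (nbhs v)); first exact: cvg_cst.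
by apply: (@cvg_big_prod _ (nbhs v)) => i _; exact: continuous_vec_mx_entry.
Qed.

Lemma continuous_penalized_loss n (Chat Lam : 'M[R]_n) (v : 'rV[R]_(n * n)) :
  0 < \det (vec_mx v : 'M[R]_n) ->
  penalized_loss Chat Lam (vec_mx u) @[u --> v] --> penalized_loss Chat Lam (vec_mx v).
Proof.
move=> dv; rewrite /penalized_loss /loss; apply: (@cvgD _ _ _ (nbhs v)); first apply: (@cvgB _ _ _ (nbhs v)).
- rewrite inner_mxE; under eq_fun do rewrite inner_mxE.
  apply: (@cvg_big_sum _ (nbhs v)) => p _; apply: (@cvgM _ _ (nbhs v)); last exact: cvg_cst.
  exact: continuous_vec_mx_entry.
- apply: (@continuous_cvg _ _ _ (nbhs v)); first exact: continuous_ln.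
  exact: continuous_det_vec_mx.
- apply: (@cvg_big_sum _ (nbhs v)) => i _; apply: (@cvg_big_sum _ (nbhs v)) => j _.
  apply: cvg_norm; rewrite mxE; under eq_fun do rewrite mxE.
  by apply: (@cvgM _ _ (nbhs v)); [exact: cvg_cst|exact: continuous_vec_mx_entry].
Qed.

Lemma continuous_frobenius_vec_mx n (P : 'M[R]_n) :
  continuous (fun v : 'rV[R]_(n * n) => frobenius_norm (vec_mx v - P)).
Proof.
move=> v; rewrite /frobenius_norm; apply: (@continuous_cvg _ _ _ (nbhs v)); first exact: sqrt_continuous.
apply: (@cvg_big_sum _ (nbhs v)) => i _; apply: (@cvg_big_sum _ (nbhs v)) => j _.
have h : (vec_mx u - P) i j @[u --> v] --> (vec_mx v - P) i j.
  rewrite mxE; under eq_fun do rewrite mxE.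
  by apply: (@cvgD _ _ _ (nbhs v)); [exact: continuous_vec_mx_entry|exact: cvg_cst].
by rewrite expr2; under eq_fun do rewrite expr2; exact: cvgM.
Qed.

(** Positive definiteness is not a closed condition, so the compact set records only symmetry and
    distance; on a small ball these imply it. Matrices are flattened to row vectors so that
    [bounded_closed_compact] applies. *)
Lemma compact_frobenius_ball n (P : 'M[R]_n) r :
  compact [set v : 'rV[R]_(n * n) | (vec_mx v)^T = (vec_mx v : 'M[R]_n) /\
    frobenius_norm (vec_mx v - P) <= r].
Proof.
apply: bounded_closed_compact.
- exists (r + \sum_(p : 'I_n * 'I_n) `|P p.1 p.2|); split; first exact: num_real.
  move=> M /ltW rM v [_ vr]; apply: le_trans rM.
  rewrite [leLHS]/Num.Def.normr /= mx_normrE; apply: bigmax_le => /=.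
    apply: addr_ge0; last by apply: sumr_ge0.
    exact: le_trans (frobenius_norm_ge0 _) vr.
  move=> [i k] _ /=; rewrite ord1.
  case/mxvec_indexP: k => a b.
  have -> : v 0 (mxvec_index a b) = (vec_mx v - P) a b + P a b.
    by rewrite !mxE subrK.
  apply: le_trans (ler_normD _ _) _; apply: lerD.
    exact: le_trans (frobenius_norm_entry _ _ _) vr.
  by rewrite (bigD1 (a, b))//= lerDl; apply: sumr_ge0.
- rewrite (_ : [set v | _] = \bigcap_(p : 'I_n * 'I_n)
      [set v : 'rV[R]_(n * n) | vec_mx v p.2 p.1 - vec_mx v p.1 p.2 = 0 ] `&`
      [set v : 'rV[R]_(n * n) | frobenius_norm (vec_mx v - P) <= r]); last first.
    apply/seteqP; split => v /= [vt vr]; split => //.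
      by move=> [i j] _ /=; rewrite -[in X in X - _]vt mxE subrr.
    by apply/matrixP => i j; rewrite mxE; apply/subr0_eq/(vt (i, j)).
  apply: closedI.
    apply: closed_bigI => p _.
    apply: (@closed_comp _ _ (fun v : 'rV[R]_(n * n) => vec_mx v p.2 p.1 - vec_mx v p.1 p.2)
      [set x | x = 0]); last exact: closed_eq.
    move=> v _; apply: continuousB; exact: continuous_vec_mx_entry.
  apply: (@closed_comp _ _ (fun v : 'rV[R]_(n * n) => frobenius_norm (vec_mx v - P))
      [set x | x <= r]); last exact: closed_le.
  by move=> v _; exact: continuous_frobenius_vec_mx.
Qed.

Lemma penalized_loss_convex n (Chat Lam A B : 'M[R]_n) t :
  (forall i j, 0 <= Lam i j) -> posdef A -> posdef B -> 0 <= t <= 1 ->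
  penalized_loss Chat Lam ((1 - t) *: A + t *: B) <=
  (1 - t) * penalized_loss Chat Lam A + t * penalized_loss Chat Lam B.
Proof.
move=> L0 Ap Bp t01; have := ln_det_concave Ap Bp t01.
rewrite /penalized_loss /loss.
have -> : inner_mx ((1 - t) *: A + t *: B) Chat =
    (1 - t) * inner_mx A Chat + t * inner_mx B Chat.
  rewrite !inner_mxE !mulr_sumr -big_split; apply: eq_bigr => p _ /=.
  by rewrite !mxE; ring.
have : off_norm1 (hadamard Lam ((1 - t) *: A + t *: B)) <=
    (1 - t) * off_norm1 (hadamard Lam A) + t * off_norm1 (hadamard Lam B).
  rewrite /off_norm1 !mulr_sumr -big_split; apply: ler_sum => i _ /=.
  rewrite !mulr_sumr -big_split; apply: ler_sum => j _ /=.
  case/andP: t01 => t0 t1; rewrite !mxE !normrM (ger0_norm (L0 i j)).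
  rewrite ![_ * (Lam i j * _)]mulrCA -mulrDr ler_wpM2l//.
  apply: le_trans (ler_normD _ _) _.
  by rewrite !normrM (ger0_norm t0) ger0_norm ?subr_ge0.
move: (off_norm1 _) (off_norm1 _) (off_norm1 _) => a b c.
move: (ln _) (ln _) (ln _) (inner_mx _ _) (inner_mx _ _) => x y z u v; lra.
Qed.

(** A point beyond [r0] is joined to [P] by a segment that crosses the sphere of radius [r0], where
    the loss exceeds its value at [P]; by convexity it does so at the far end too. Hence a minimum
    over the compact ball is global, and no minimizer lies outside radius [rho]. *)
Lemma penalized_loss_localize n (Chat Lam P : 'M[R]_n) r0 rho :
  (forall i j, 0 <= Lam i j) -> posdef P -> 0 <= rho < r0 ->
  (forall B : 'M[R]_n, B^T = B -> frobenius_norm (B - P) <= r0 -> posdef B) ->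
  (forall B, posdef B -> rho < frobenius_norm (B - P) <= r0 ->
     penalized_loss Chat Lam P < penalized_loss Chat Lam B) ->
  (exists B, is_argmin (@posdef R n) (penalized_loss Chat Lam) B) /\
  (forall B, is_argmin (@posdef R n) (penalized_loss Chat Lam) B ->
     frobenius_norm (B - P) <= rho).
Proof.
move=> L0 Pp /andP[rho0 rhor] ballp fP; set f := penalized_loss Chat Lam in fP *.
have r00 : 0 < r0 by exact: le_lt_trans rhor.
have far B : posdef B -> r0 < frobenius_norm (B - P) -> f P < f B.
  move=> Bp; set N := frobenius_norm (B - P) => rN.
  have N0 : 0 < N by exact: lt_trans rN.
  pose t := r0 / N; have t01 : 0 <= t <= 1.
    by rewrite divr_ge0 ?(ltW r00) ?(ltW N0)//= ler_pdivrMr// mul1r ltW.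
  have t0 : 0 < t by rewrite divr_gt0.
  have := penalized_loss_convex Chat L0 Pp Bp t01.
  set Bt := _ *: P + _ *: B; rewrite -/f => fBt.
  have : f P < f Bt.
    apply: fP; first exact: posdef_conv.
    have -> : Bt - P = t *: (B - P).
      rewrite /Bt scalerBl scale1r scalerBr addrAC [P - _ - P]addrAC subrr.
      by rewrite sub0r addrC.
    rewrite frobenius_normZ ger0_norm ?(ltW t0)// -/N /t divfK ?gt_eqF//.
    by rewrite rhor lexx.
  by move: t01 fBt; move: (f _) (f _) (f _) => a b c /andP[_ t1] h1 h2; nra.
split; last first.
  move=> B [Bp Bmin]; rewrite leNgt; apply/negP => rhoB.
  have := Bmin P Pp; apply/negP; rewrite -ltNge.
  have [Br|Br] := leP (frobenius_norm (B - P)) r0; last exact: far.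
  by apply: fP => //; rewrite rhoB Br.
pose K := [set v : 'rV[R]_(n * n) | (vec_mx v)^T = (vec_mx v : 'M[R]_n) /\
    frobenius_norm (vec_mx v - P) <= r0].
have Kp v : K v -> posdef (vec_mx v) by case => vt vr; exact: ballp.
have KP : K (mxvec P).
  split; rewrite mxvecK ?Pp.1// subrr.
  by rewrite -(scale0r P) frobenius_normZ normr0 mul0r ltW.
have [||v vK vmin] := @compact_EVT_min _ R (fun v => f (vec_mx v)) K _
    (@compact_frobenius_ball n P r0).
- by exists (mxvec P).
- apply: continuous_in_subspaceT => v /set_mem vK.
  by apply: continuous_penalized_loss; exact/posdef_det_gt0/Kp.
exists (vec_mx v); split; first exact/Kp/set_mem.
move=> B Bp; have [Br|Br] := leP (frobenius_norm (B - P)) r0.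
  have := vmin (mxvec B); rewrite mxvecK; apply; apply/mem_set.
  by split; rewrite mxvecK ?Bp.1.
apply: le_trans (ltW (far B Bp Br)).
by have := vmin (mxvec P); rewrite mxvecK; apply; exact/mem_set.
Qed.

End PenalizedLoss.

(** * One step of the adaptive procedure *)

Section Step.
Context {R : realType}.

Lemma frobenius_norm0 m n : frobenius_norm (0 : 'M[R]_(m, n)) = 0.
Proof. by rewrite -(scale0r 0) frobenius_normZ normr0 mul0r. Qed.

Lemma frobenius_mulmx_le m n (A : 'M[R]_(m, n)) (x : 'cV[R]_n) :
  frobenius_norm (A *m x) <= frobenius_norm A * frobenius_norm x.
Proof.
rewrite -(@ler_pXn2r _ 2)// ?nnegrE ?mulr_ge0 ?frobenius_norm_ge0//.
rewrite exprMn !frobenius_sqr /inner_mx.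
have E (k l : nat) (B : 'M[R]_(k, l)) : \tr (B^T *m B) = \sum_i \sum_j B i j ^+ 2.
  rewrite -/(inner_mx B B) -frobenius_sqr sqr_sqrtr//.
  by apply: sumr_ge0 => i _; apply: sumr_ge0 => j _; exact: sqr_ge0.
rewrite !E mulr_suml; apply: ler_sum => i _.
rewrite big_ord1 mxE.
have -> : \sum_i0 \sum_j x i0 j ^+ 2 = \sum_j x j 0 ^+ 2.
  by apply: eq_bigr => j _; rewrite big_ord1.
have s0 (I : finType) (a : I -> R) : 0 <= \sum_i a i ^+ 2.
  by apply: sumr_ge0 => k _; exact: sqr_ge0.
have nn : forall y : R, y ^+ 2 = `|y| ^+ 2 by move=> y; rewrite real_normK ?num_real.
rewrite -[leRHS]sqr_sqrtr ?mulr_ge0// sqrtrM// nn.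
rewrite ler_pXn2r// ?nnegrE ?mulr_ge0 ?sqrtr_ge0//.
exact: norm_sum_cauchy_schwarz.
Qed.

Lemma spectral_norm_has_sup m n (A : 'M[R]_(m, n)) :
  has_sup [set frobenius_norm (A *m x) |
    x in [set x : 'cV[R]_n | frobenius_norm x <= 1]].
Proof.
split.
  by exists (frobenius_norm (A *m (0 : 'cV_n))), 0; rewrite //= frobenius_norm0.
exists (frobenius_norm A) => _ [x /= x1 <-].
apply: le_trans (frobenius_mulmx_le _ _) _.
by rewrite ler_piMr// frobenius_norm_ge0.
Qed.

Lemma spectral_norm_le m n (A : 'M[R]_(m, n)) (x : 'cV[R]_n) :
  frobenius_norm (A *m x) <= spectral_norm A * frobenius_norm x.
Proof.
have [x0|x0] := eqVneq (frobenius_norm x) 0.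
  by rewrite (frobenius_norm_eq0 x0) mulmx0 !frobenius_norm0 mulr0.
have xp : 0 < frobenius_norm x by rewrite lt0r x0 frobenius_norm_ge0.
rewrite -ler_pdivrMr// mulrC.
have -> : (frobenius_norm x)^-1 * frobenius_norm (A *m x) =
    frobenius_norm (A *m ((frobenius_norm x)^-1 *: x)).
  by rewrite -scalemxAr frobenius_normZ ger0_norm// invr_ge0 ltW.
have [_ hb] := spectral_norm_has_sup A.
apply: ub_le_sup => //=; exists ((frobenius_norm x)^-1 *: x) => //=.
by rewrite frobenius_normZ ger0_norm ?invr_ge0 ?(ltW xp)// mulVf.
Qed.

Lemma qf_le_norm n (A : 'M[R]_n) (x : 'cV[R]_n) k :
  frobenius_norm (A *m x) <= k * frobenius_norm x ->
  qf A x <= k * frobenius_norm x ^+ 2.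
Proof.
move=> h; rewrite qfE; apply: le_trans (inner_mx_le _ _) _.
by rewrite expr2 mulrA mulrC ler_wpM2r// frobenius_norm_ge0.
Qed.

Lemma qf_ge_frobenius n (A : 'M[R]_n) (x : 'cV[R]_n) :
  - (frobenius_norm A * frobenius_norm x ^+ 2) <= qf A x.
Proof.
rewrite lerNl -mulN1r -qfZ; apply: qf_le_norm.
apply: le_trans (frobenius_mulmx_le _ _) _.
by rewrite frobenius_normZ normrN1 mul1r.
Qed.

(** The cofactors along row [i] do not involve row [i], so the determinant is affine in each
    entry. *)
Lemma det_add_delta n (A : 'M[R]_n) h i j :
  \det (h *: delta_mx i j + A) = \det A + h * cofactor A i j.
Proof.
rewrite (expand_det_row _ i) (expand_det_row A i) (bigD1 j)//= [in RHS](bigD1 j)//=.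
have cofE k : cofactor (h *: delta_mx i j + A) i k = cofactor A i k.
  rewrite /cofactor; congr (_ * \det _); apply/matrixP => a b.
  by rewrite !mxE eq_sym (negbTE (neq_lift _ _)) /= mulr0 add0r.
rewrite cofE !mxE !eqxx mulr1 mulrDl [h * _ + _]addrC -!addrA; congr (_ + _).
rewrite addrC; congr (_ + _); apply: eq_bigr => k kj.
by rewrite cofE !mxE eqxx (negbTE kj) /= mulr0 add0r.
Qed.

(** The directions [delta_mx i j] leave the symmetric matrices, so the derivative is computed from
    the determinant itself; symmetry of [P] identifies the quotient of cofactor and determinant with
    the entry of the inverse. *)
Lemma gradient_loss n (Chat P : 'M[R]_n) : posdef P ->
  gradient (loss Chat) P = Chat - invmx P.
Proof.
move=> Pp; apply/matrixP => i j; rewrite !mxE.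
have dP := posdef_det_gt0 Pp.
pose c := cofactor P i j / \det P.
have cE : invmx P i j = c.
  have <- : (invmx P)^T = invmx P by rewrite trmx_inv Pp.1.
  by rewrite /invmx posdef_unit// !mxE mulrC.
rewrite cE; apply: cvg_lim => //.
pose g (h : R^o) : R^o := h * Chat i j - ln (1 + h * c).
have gd : is_derive (0 : R^o) 1 g (Chat i j - c).
  have ln1 : is_derive (1 + 0 * c) 1 (@ln R : R^o -> R^o) 1.
    by rewrite mul0r addr0 -[X in is_derive _ _ _ X]invr1; exact: is_derive1_ln.
  have lin : is_derive (0 : R^o) (1 : R^o) (fun h : R^o => 1 + h * c : R^o) c.
    by apply: is_derive_eq; rewrite /GRing.scale /=; ring.
  have lnd := @is_derive1_comp R (@ln R) (fun h => 1 + h * c) 0 1 c ln1 lin.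
  have lin2 : is_derive (0 : R^o) (1 : R^o) (fun h : R^o => h * Chat i j : R^o) (Chat i j).
    by apply: is_derive_eq; rewrite /GRing.scale /=; ring.
  by apply: is_derive_eq; rewrite /GRing.scale /=; ring.
have gcvg : h^-1 *: (g h - g 0) @[h --> (0 : R)^'] --> Chat i j - c.
  rewrite -[X in _ --> X](@derive_val _ _ _ _ _ _ _ gd).
  have := @ex_derive _ _ _ _ _ _ _ gd; rewrite /derivable /derive.
  by under eq_fun do rewrite /= addr0 [_ *: 1]mulr1.
apply: cvg_trans gcvg; apply: near_eq_cvg; near=> h.
(* For small [h] the perturbed determinant stays positive, so the logarithm of the product splits
   and the difference quotient is that of [g]. *)
have h1 : 0 < 1 + h * c.
  have : `|h| * (`|c| + 1) < 1.
    rewrite -ltr_pdivlMr ?ltr_wpDl// div1r.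
    near: h; apply: dnbhs0_lt; by rewrite invr_gt0 ltr_wpDl.
  have := ler_norm (- (h * c)); rewrite normrN normrM.
  by have := normr_ge0 h; lra.
congr (_ *: _); rewrite /g /loss /= !mul0r addr0 ln1 !subr0 det_add_delta.
have -> : \det P + h * cofactor P i j = \det P * (1 + h * c).
  by rewrite /c; field; exact: lt0r_neq0.
rewrite lnM ?posrE// !inner_mxE.
have -> : \sum_p (h *: delta_mx i j + P) p.1 p.2 * Chat p.1 p.2 =
    h * Chat i j + \sum_p P p.1 p.2 * Chat p.1 p.2.
  under eq_bigr do rewrite !mxE mulrDl.
  rewrite big_split /=; congr (_ + _).
  rewrite (bigD1 (i, j))//= !eqxx mulr1 big1 ?addr0// => -[a b].
  by rewrite xpair_eqE /= => /negbTE ->; rewrite mulr0 mul0r.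
rewrite /=; ring.
Unshelve. all: end_near. Qed.

Lemma restrict_mx_norm_le n (A B : 'M[R]_n) (E : {set 'I_n * 'I_n}) k :
  0 <= k -> (forall i j, (i, j) \in E -> `|A i j| <= k * `|B i j|) ->
  frobenius_norm (restrict_mx E A) <= k * frobenius_norm B.
Proof.
move=> k0 AB; rewrite -[k]ger0_norm// -frobenius_normZ ler_wsqrtr//.
apply: ler_sum => i _; apply: ler_sum => j _; rewrite !mxE.
case: ifPn => [ijE|_]; last by rewrite expr0n sqr_ge0.
rewrite -[A i j ^+ 2]real_normK ?num_real// -[leRHS]real_normK ?num_real//.
by rewrite ler_pXn2r ?nnegrE// normrM (ger0_norm k0) AB.
Qed.

Lemma restrict_mx_norm_card n (A : 'M[R]_n) (E : {set 'I_n * 'I_n}) k s :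
  0 <= k -> (#|E| <= s)%N -> (forall i j, (i, j) \in E -> `|A i j| <= k) ->
  frobenius_norm (restrict_mx E A) <= k * Num.sqrt s%:R.
Proof.
move=> k0 Es AB; rewrite -[k]ger0_norm// -sqrtr_sqr -sqrtrM ?sqr_ge0//.
rewrite frobenius_normE ler_wsqrtr//.
apply: (@le_trans _ _ (\sum_(p in E) k ^+ 2)).
  rewrite [leRHS]big_mkcond; apply: ler_sum => -[i j] _; rewrite !mxE /=.
  case: ifPn => [ijE|_]; last by rewrite expr0n.
  by rewrite -[A i j ^+ 2]real_normK ?num_real// ler_pXn2r ?nnegrE// AB.
by rewrite sumr_const -[_ *+ _]mulr_natr ler_wpM2l ?sqr_ge0// ler_nat.
Qed.

Lemma sum_restrict_le n (A D : 'M[R]_n) (E : {set 'I_n * 'I_n}) :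
  \sum_(p : 'I_n * 'I_n) `|restrict_mx E A p.1 p.2| * `|D p.1 p.2| <=
  frobenius_norm (restrict_mx E A) * frobenius_norm D.
Proof.
apply: le_trans (sum_cauchy_schwarz _ _ _) _.
rewrite !frobenius_normE.
under [X in Num.sqrt X * _ <= _]eq_bigr do rewrite real_normK ?num_real//.
by under [X in _ * Num.sqrt X <= _]eq_bigr do rewrite real_normK ?num_real//.
Qed.

(** The quadratic term is the Bregman bound with [q = 2 * p] at the midpoint, whence
    [4 * (p * (2 * p)) = 8 * p ^+ 2]: the constant 8 of the theorem. *)
Lemma penalized_loss_gap n (Chat Lam P B : 'M[R]_n) (S E : {set 'I_n * 'I_n}) p :
  0 < p -> posdef P -> posdef B ->
  (forall x, qf P x <= p * frobenius_norm x ^+ 2) ->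
  (forall x, qf (P + 2^-1 *: (B - P)) x <= (2 * p) * frobenius_norm x ^+ 2) ->
  (forall i j, 0 <= Lam i j) ->
  (forall i, (Chat - invmx P) i i = 0) ->
  (forall i, (i, i) \notin S) ->
  (forall i j, i != j -> (i, j) \notin S -> P i j = 0) ->
  (forall i j, i != j -> (i, j) \notin S -> (i, j) \notin E ->
     `|(Chat - invmx P) i j| <= Lam i j) ->
  frobenius_norm (B - P) ^+ 2 / (8 * p ^+ 2) -
    (frobenius_norm (restrict_mx S (Chat - invmx P)) +
     frobenius_norm (restrict_mx S Lam) +
     frobenius_norm (restrict_mx E (Chat - invmx P))) * frobenius_norm (B - P) <=
  penalized_loss Chat Lam B - penalized_loss Chat Lam P.
Proof.
move=> p0 Pp Bp Pb Qb L0 G0 Sd PS GE.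
set G := Chat - invmx P in G0 GE *; set D := B - P in Qb *.
have PD : P + D = B by rewrite /D addrC subrK.
have p20 : 0 < 2 * p by rewrite mulr_gt0.
have := bregman_ln_det_ge p0 p20 Pp (_ : posdef (P + D)) Pb Qb.
rewrite PD => /(_ Bp).
have -> : 4 * (p * (2 * p)) = 8 * p ^+ 2 by ring.
have h1 : inner_mx B Chat = inner_mx P Chat + \tr (invmx P *m D) + inner_mx D G.
  have -> : \tr (invmx P *m D) = inner_mx D (invmx P).
    by rewrite /inner_mx -[RHS]mxtrace_tr trmx_mul trmxK trmx_inv Pp.1.
  rewrite !inner_mxE -!big_split; apply: eq_bigr => q _ /=.
  by rewrite /D /G !mxE; ring.
have BE i j : B i j = P i j + D i j by rewrite -PD mxE.
clearbody D G.
(* This holds entry by entry. On [S] the triangle inequality limits the decrease of the penalty; off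
   [S] the matrix [P] vanishes, so the penalty grows by [Lam i j * |D i j|], which absorbs the
   gradient term outside [E]. *)
have h2 : - \sum_(q : 'I_n * 'I_n)
    (`|restrict_mx S G q.1 q.2| * `|D q.1 q.2| +
     `|restrict_mx S Lam q.1 q.2| * `|D q.1 q.2| +
     `|restrict_mx E G q.1 q.2| * `|D q.1 q.2|) <=
    inner_mx D G + (off_norm1 (hadamard Lam B) - off_norm1 (hadamard Lam P)).
  rewrite inner_mxE /off_norm1.
  under [X in _ + (X - _)]eq_bigr do rewrite big_mkcond.
  under [X in _ + (_ - X)]eq_bigr do rewrite big_mkcond.
  rewrite !pair_bigA /= -sumrN -sumrB -big_split; apply: ler_sum => -[i j] _ /=.
  have DG : - (`|G i j| * `|D i j|) <= D i j * G i j.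
    by rewrite -normrM mulrC lerNl -normrN ler_norm.
  have [ij|ij] := eqVneq i j.
    rewrite -ij G0 mulr0 !subr0 addr0 oppr_le0.
    by rewrite !addr_ge0// mulr_ge0.
  have Lij := L0 i j.
  rewrite !mxE !normrM (ger0_norm Lij) /=.
  have [ijS|ijS] := boolP ((i, j) \in S).
    rewrite (ger0_norm Lij) -mulrBr.
    have BPD : - `|D i j| <= `|B i j| - `|P i j|.
      by rewrite BE; have := ler_normB (P i j + D i j) (D i j); rewrite addrK; lra.
    have := ler_wpM2l Lij BPD.
    have : 0 <= `|if (i, j) \in E then G i j else 0| * `|D i j| by rewrite mulr_ge0.
    by move: (`|if _ then _ else _| * _) => X; lra.
  have Pij := PS _ _ ij ijS.
  have DB : D i j = B i j by rewrite BE Pij add0r.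
  rewrite Pij !normr0 !mul0r mulr0 subr0 !add0r -DB.
  have [ijE|ijE] := boolP ((i, j) \in E).
    by have := mulr_ge0 Lij (normr_ge0 (D i j)); lra.
  have := ler_wpM2r (normr_ge0 (D i j)) (GE _ _ ij ijS ijE).
  by rewrite normr0 mul0r oppr0; lra.
rewrite !big_split /= in h2.
have h3 := sum_restrict_le G D S; have h4 := sum_restrict_le Lam D S.
have h5 := sum_restrict_le G D E.
rewrite /penalized_loss /loss h1 !mulrDl.
move: h2 h3 h4 h5.
move: (_ / _) (ln _) (ln _) (\tr _) (off_norm1 _) (off_norm1 _) (inner_mx _ _) (inner_mx _ _).
move=> a b c x y z u v; move: (\sum__ _) (\sum__ _) (\sum__ _) => s1 s2 s3.
move: (_ * _) (_ * _) (_ * _) => t1 t2 t3; lra.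
Qed.

(** Outside this set and off [S] the penalty level is at least [lambda / 2], which dominates a
    gradient entry of size [lambda / 4]. *)
Definition small_weight_set n (w : R -> R) (S : {set 'I_n * 'I_n}) (A : 'M[R]_n)
    : {set 'I_n * 'I_n} :=
  [set q | [&& q.1 != q.2, q \notin S & w `|A q.1 q.2| < 2^-1]].

(** * One iteration for a fixed realization of the sample *)

Section AdaptiveStep.
Variables (n s : nat) (Chat P : 'M[R]_n) (S : {set 'I_n * 'I_n}) (w : R -> R).
Variables (lambda alpha c r0 p : R).
Hypotheses (Pp : posdef P) (p0 : 0 < p)
  (Pb : forall x, qf P x <= p * frobenius_norm x ^+ 2)
  (ballp : forall B : 'M[R]_n, B^T = B -> frobenius_norm (B - P) <= r0 -> posdef B)
  (r0p : r0 <= p) (lamr0 : 16 * p ^+ 2 * (lambda * Num.sqrt s%:R) < r0).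
Hypotheses (Sd : forall i, (i, i) \notin S) (Ss : (#|S| <= s)%N)
  (PS : forall i j, i != j -> (i, j) \notin S -> P i j = 0)
  (PSge : forall i j, (i, j) \in S -> (alpha + c) * lambda <= `|P i j|).
Hypotheses (whomo : {homo w : x y / x <= y >-> y <= x})
  (w01 : forall t, 0 <= t -> 0 <= w t <= 1) (w1 : forall t, t <= 0 -> w t = 1)
  (walpha : w (alpha * lambda) = 0) (wc : 2^-1 <= w (c * lambda)).
Hypotheses (lam0 : 0 < lambda) (cp : 64 * p ^+ 2 <= c).
Hypotheses (G0 : forall i, (Chat - invmx P) i i = 0)
  (Gle : forall i j, `|(Chat - invmx P) i j| <= lambda / 4).

Local Notation G := (Chat - invmx P).

Let p20 : 0 < p ^+ 2. Proof. by rewrite exprn_gt0. Qed.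
Let c0 : 0 < c. Proof. by apply: lt_le_trans cp; rewrite mulr_gt0. Qed.
Let sq0 : 0 <= Num.sqrt (s%:R : R). Proof. exact: sqrtr_ge0. Qed.

(** Since [w] is nonincreasing and [w (c * lambda)] is at least 1/2, a smaller weight means a large
    entry, and off the support that entry is pure error. *)
Lemma weight_large_of_small (A : 'M[R]_n) i j :
  (i, j) \in small_weight_set w S A -> c * lambda <= `|(A - P) i j|.
Proof.
rewrite inE /= => /and3P[ij ijS wA]; rewrite !mxE PS// subr0.
rewrite leNgt; apply/negP => /ltW /whomo; apply/negP; rewrite -ltNge.
exact: lt_le_trans wA wc.
Qed.

(** On the support, an entry of [prev] beyond [alpha * lambda] has weight 0; otherwise the lower
    bound on [P i j] leaves an error of at least [c * lambda], and the weight is at most 1. *)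
Lemma weight_off_support_norm (prev : 'M[R]_n) :
  frobenius_norm (restrict_mx S (weights w lambda prev)) <=
  c^-1 * frobenius_norm (prev - P).
Proof.
apply: restrict_mx_norm_le => [|i j ijS]; first by rewrite invr_ge0 ltW.
have /andP[wp0 wp1] := w01 (normr_ge0 (prev i j)).
rewrite mxE ger0_norm ?mulr_ge0 ?(ltW lam0)// ler_pdivlMl//.
have [/whomo|/ltW prevlt] := leP (alpha * lambda) `|prev i j|.
  rewrite walpha => w0; have -> : w `|prev i j| = 0 by apply/eqP; rewrite eq_le w0.
  by rewrite !mulr0.
apply: (@le_trans _ _ (c * lambda)).
  by rewrite ler_wpM2l ?(ltW c0)// ler_piMr// ltW.
have := PSge ijS; rewrite !mxE; have := ler_normB (prev i j) (prev i j - P i j).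
by rewrite subKr; lra.
Qed.

(** The localization radius is bounded in two ways: through the previous error, for the contraction,
    and through the cardinalities, for an absolute bound. The latter limits the number of new small
    weights, which is what the next step requires of [prev]. *)
Lemma adaptive_argmin (prev : 'M[R]_n) :
  (#|small_weight_set w S prev| <= s)%N ->
  let Lam := weights w lambda prev in
  (exists B, is_argmin (@posdef R n) (penalized_loss Chat Lam) B) /\
  (forall B, is_argmin (@posdef R n) (penalized_loss Chat Lam) B ->
    [/\ frobenius_norm (B - P) <=
          8 * p ^+ 2 * frobenius_norm (restrict_mx S G)
          + 2^-1 * frobenius_norm (prev - P),
        frobenius_norm (B - P) <= 16 * p ^+ 2 * (lambda * Num.sqrt s%:R)
      & (#|small_weight_set w S B| <= s)%N]).
Proof.
move=> Es Lam; set E := small_weight_set w S prev in Es.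
have Lam0 i j : 0 <= Lam i j.
  by rewrite mxE mulr_ge0 ?(ltW lam0)//; case/andP: (w01 (normr_ge0 (prev i j))).
have nS : frobenius_norm (restrict_mx S G) <= lambda / 4 * Num.sqrt s%:R.
  by apply: restrict_mx_norm_card => // *; rewrite ?Gle//; apply: divr_ge0; rewrite ?ltW.
have nE : frobenius_norm (restrict_mx E G) <= lambda / 4 * Num.sqrt s%:R.
  by apply: restrict_mx_norm_card => // *; rewrite ?Gle//; apply: divr_ge0; rewrite ?ltW.
have nL : frobenius_norm (restrict_mx S Lam) <= lambda * Num.sqrt s%:R.
  apply: restrict_mx_norm_card => //; first exact: ltW.
  move=> i j _; rewrite ger0_norm// mxE ler_piMr ?(ltW lam0)//.
  by case/andP: (w01 (normr_ge0 (prev i j))).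
have nL2 := weight_off_support_norm prev; rewrite -/Lam in nL2.
have nE2 : frobenius_norm (restrict_mx E G) <= (4 * c)^-1 * frobenius_norm (prev - P).
  apply: restrict_mx_norm_le => [|i j ijE]; first by rewrite invr_ge0 mulr_ge0 ?(ltW c0).
  apply: le_trans (Gle i j) _; rewrite ler_pdivlMl ?mulr_gt0//.
  by have := weight_large_of_small ijE; lra.
have nonneg := @frobenius_norm_ge0 R n n.
(* At this radius the quadratic and the linear term of [penalized_loss_gap] balance. *)
pose rho := 8 * p ^+ 2 * (frobenius_norm (restrict_mx S G) +
     frobenius_norm (restrict_mx S Lam) + frobenius_norm (restrict_mx E G)).
have rho0 : 0 <= rho by rewrite mulr_ge0 ?addr_ge0// mulr_ge0// ltW.
have rho16 : rho <= 16 * p ^+ 2 * (lambda * Num.sqrt s%:R).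
  rewrite /rho (_ : 16 * _ * _ = 8 * p ^+ 2 * (2 * (lambda * Num.sqrt s%:R))); last by ring.
  apply: ler_wpM2l; first by rewrite mulr_ge0// ltW.
  have := mulr_ge0 (ltW lam0) sq0; move: nS nE nL; rewrite ![lambda / 4 * _]mulrAC.
  by move: (lambda * _) => t; lra.
have rho2 : rho <= 8 * p ^+ 2 * frobenius_norm (restrict_mx S G)
          + 2^-1 * frobenius_norm (prev - P).
  rewrite /rho -addrA mulrDr lerD2l.
  apply: (@le_trans _ _ (8 * p ^+ 2 * (c^-1 * frobenius_norm (prev - P) +
     (4 * c)^-1 * frobenius_norm (prev - P)))).
    by apply: ler_wpM2l; [rewrite mulr_ge0// ltW | exact: lerD].
  rewrite -mulrDl mulrA ler_wpM2r//.
  (* The weights on [S] contribute 1/c and the gradient on [E] contributes 1/(4c);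
     [64 * p ^+ 2 <= c] makes the factor less than 1/2. *)
  have -> : 8 * p ^+ 2 * (c^-1 + (4 * c)^-1) = 10 * p ^+ 2 / c.
    by field; exact: lt0r_neq0.
  by rewrite ler_pdivrMr//; move: p20 cp; move: (p ^+ 2) => y; lra.
have rhor : 0 <= rho < r0 by rewrite rho0 (le_lt_trans rho16).
have gap B : posdef B -> rho < frobenius_norm (B - P) <= r0 ->
    penalized_loss Chat Lam P < penalized_loss Chat Lam B.
  move=> Bp /andP[rhoB Br0].
  have Qb x : qf (P + 2^-1 *: (B - P)) x <= (2 * p) * frobenius_norm x ^+ 2.
    rewrite qfD qfZ; have := Pb x.
    have : qf (B - P) x <= p * frobenius_norm x ^+ 2.
      apply: qf_le_norm; apply: le_trans (frobenius_mulmx_le _ _) _.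
      by rewrite ler_wpM2r ?frobenius_norm_ge0// (le_trans Br0).
    have := exprn_ge0 2 (frobenius_norm_ge0 x).
    move: (qf _ _) (qf _ _) (_ ^+ 2) => a b y h0 h1 h2.
    have := mulr_ge0 (ltW p0) h0; lra.
  have := @penalized_loss_gap _ Chat Lam P B S E p p0 Pp Bp Pb Qb Lam0 G0 Sd PS.
  rewrite -subr_gt0; move=> H; apply: lt_le_trans (H _).
    have N0 : 0 < frobenius_norm (B - P) by exact: le_lt_trans rhoB.
    rewrite expr2 -mulrA [X in _ - X]mulrC -mulrBr mulr_gt0// subr_gt0.
    by rewrite ltr_pdivlMr ?mulr_gt0// mulrC.
  move=> i j ij ijS ijE; apply: le_trans (Gle i j) _; rewrite mxE ler_wpM2l ?(ltW lam0)//.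
  move: ijE; rewrite inE /= ij ijS /= -leNgt; apply: le_trans.
  by rewrite lef_pV2 ?posrE// ler_nat.
have [ex bd] := penalized_loss_localize Lam0 Pp rhor ballp gap.
split=> // B Bmin; have Brho := bd B Bmin; split; [exact: le_trans rho2|exact: le_trans rho16|].
set F := small_weight_set w S B.
(* Each entry in [F] contributes at least [(c * lambda) ^+ 2] to the squared error, which is at most
   [(16 * p ^+ 2 * lambda) ^+ 2 * s]. *)
have : (c * lambda) ^+ 2 * #|F|%:R <= (c * lambda) ^+ 2 * s%:R.
  apply: (@le_trans _ _ (frobenius_norm (B - P) ^+ 2)).
    rewrite frobenius_sqr inner_mxE mulr_natr -sumr_const big_mkcond /=.
    apply: ler_sum => -[i j] _ /=; rewrite -expr2; case: ifPn => [ijF|_]; last exact: sqr_ge0.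
    rewrite -[leRHS]real_normK ?num_real// ler_pXn2r ?nnegrE ?mulr_ge0 ?(ltW c0) ?(ltW lam0)//.
    exact: weight_large_of_small.
  apply: (@le_trans _ _ ((c * lambda * Num.sqrt s%:R) ^+ 2)).
    rewrite ler_pXn2r ?nnegrE ?mulr_ge0 ?(ltW c0) ?(ltW lam0)//.
    apply: le_trans Brho _; apply: le_trans rho16 _; rewrite mulrA ler_wpM2r// ler_wpM2r ?(ltW lam0)//.
    by move: p20 cp; move: (p ^+ 2) => y; lra.
  by rewrite exprMn sqr_sqrtr.
by rewrite ler_pM2l ?exprn_gt0 ?mulr_gt0// ler_nat.
Qed.

Lemma adaptive_est_spec l :
  (#|small_weight_set w S (adaptive_est w lambda Chat l)| <= s)%N /\
  ((0 < l)%N ->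
    [/\ est_is_argmin w lambda Chat l,
        frobenius_norm (adaptive_est w lambda Chat l - P) <=
          8 * p ^+ 2 * frobenius_norm (restrict_mx S G)
          + 2^-1 * frobenius_norm (adaptive_est w lambda Chat l.-1 - P)
      & frobenius_norm (adaptive_est w lambda Chat l - P) <=
          16 * p ^+ 2 * (lambda * Num.sqrt s%:R)]).
Proof.
elim: l => [|l [IH _]].
  split=> //; rewrite (_ : small_weight_set _ _ _ = finset.set0) ?cards0//.
  apply/setP => -[i j]; rewrite !inE mxE normr0 w1//.
  by rewrite ltNge (_ : 2^-1 <= 1 = true) ?andbF// invf_le1 ?ler1n.
have [[B Bmin] Bb] := adaptive_argmin IH.
(* Existence of a minimizer rules out the default value of [xget]. *)
have am : est_is_argmin w lambda Chat l.+1 by rewrite /est_is_argmin /=; exact: (@xgetPex _ _ _ (ex_intro _ B Bmin)).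
by have [b1 b2 b3] := Bb _ am.
Qed.

End AdaptiveStep.

End Step.

(** * Independence *)

Section WeightedComposition.
Local Open Scope ereal_scope.
Context {R : realType} {d1 d2 : measure_display}.
Context {T1 : measurableType d1} {T2 : measurableType d2}.
Variables (mu : {measure set T1 -> \bar R}) (nu : {measure set T2 -> \bar R}).
Variables (H : T1 -> R) (X : T1 -> T2) (c : R).
Hypotheses (mH : measurable_fun setT H) (H0 : forall x, (0 <= H x)%R).
Hypothesis mX : measurable_fun setT X.
Hypothesis HX : forall B, measurable B ->
  \int[mu]_x (H x * \1_B (X x))%:E = c%:E * nu B.

Import HBNNSimple.

Let nnsfun_case (g : {nnsfun T2 >-> R}) :
  \int[mu]_x ((H x)%:E * (g (X x))%:E) = c%:E * \int[nu]_y (g y)%:E.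
Proof.
have mind r : measurable (g @^-1` [set r]) by exact: measurable_sfunP.
have mHi r : measurable_fun setT (fun x => (H x * \1_(g @^-1` [set r]) (X x))%:E).
  apply/measurable_EFinP; apply: measurable_funM => //.
  by apply: (measurableT_comp _ mX); exact: measurable_indic.
have k0 r x : 0 <= r%:E * (\1_(g @^-1` [set r]) x)%:E by exact: nnfun_muleindic_ge0.
transitivity (\int[mu]_x (\sum_(r \in range g)
    r%:E * (H x * \1_(g @^-1` [set r]) (X x))%:E)).
  apply: eq_integral => x _; rewrite -EFinM fimfunE.
  rewrite fsbig_finite// mulr_sumr -sumEFin fsbig_finite//.
  by apply: eq_bigr => r _; rewrite -EFinM mulrCA.
rewrite ge0_integral_fsum//; last 2 first.
- by move=> r; exact: emeasurable_funM.
- by move=> r x _; rewrite EFinM muleCA mule_ge0// lee_fin.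
transitivity (c%:E * \int[nu]_y (\sum_(r \in range g)
    r%:E * (\1_(g @^-1` [set r]) y)%:E)); last first.
  congr (_ * _); apply: eq_integral => y _; rewrite fimfunE.
  rewrite fsbig_finite// fsbig_finite// -sumEFin.
  by apply: eq_bigr => r _; rewrite EFinM.
rewrite ge0_integral_fsum//; last first.
  by move=> r; apply: emeasurable_funM => //; exact/measurable_EFinP/measurable_indic.
rewrite ge0_mule_fsumr; last first.
  by move=> r; apply: integral_ge0 => y _.
apply: eq_fsbigr => r; rewrite inE => -[t _ <-].
rewrite ge0_integralZl_EFin//; last by move=> x _; rewrite lee_fin mulr_ge0.
rewrite HX// ge0_integralZl_EFin//; last by exact/measurable_EFinP/measurable_indic.
by rewrite integral_indic// setIT muleCA.
Qed.

(** Simple functions and monotone convergence extend the identity from sets. It serves three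
    purposes: [H] is the product of the other factors in the independence argument, a normal density
    with [X] the identity, and the constant 1 for the law of a linear form. *)
Lemma integral_weighted_comp (f : T2 -> \bar R) :
  measurable_fun setT f -> (forall y, 0 <= f y) ->
  \int[mu]_x ((H x)%:E * f (X x)) = c%:E * \int[nu]_y f y.
Proof.
move=> mf f0; pose h := nnsfun_approx measurableT mf.
have fE y : f y = lim ((EFin \o h n) y @[n --> \oo]).
  by apply/esym/cvg_lim => //; exact: cvg_nnsfun_approx.
have hnu : (\int[nu]_y (h n y)%:E) @[n --> \oo] --> \int[nu]_y f y.
  under [X in _ --> X]eq_integral do rewrite fE.
  apply: (@cvg_monotone_convergence _ _ _ nu setT measurableT (fun n y => (h n y)%:E)).
  - by move=> n; exact/measurable_EFinP.
  - by move=> n y _; rewrite lee_fin.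
  - by move=> y _ a b ab; rewrite lee_fin; exact/lefP/nd_nnsfun_approx.
have hmu : (\int[mu]_x ((H x)%:E * (h n (X x))%:E)) @[n --> \oo] -->
    \int[mu]_x ((H x)%:E * f (X x)).
  have HfE x : (H x)%:E * f (X x) = lim ((H x)%:E * (h n (X x))%:E @[n --> \oo]).
    apply/esym/cvg_lim => //; apply: cvgeZl => //; exact: cvg_nnsfun_approx.
  under [X in _ --> X]eq_integral do rewrite HfE.
  apply: (@cvg_monotone_convergence _ _ _ mu setT measurableT
    (fun n x => (H x)%:E * (h n (X x))%:E)).
  - move=> n; apply: emeasurable_funM; first exact/measurable_EFinP.
    by apply/measurable_EFinP; exact: measurableT_comp.
  - by move=> n x _; rewrite mule_ge0 ?lee_fin.
  - by move=> x _ a b ab; rewrite lee_wpmul2l ?lee_fin//; exact/lefP/nd_nnsfun_approx.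
have : (c%:E * \int[nu]_y (h n y)%:E) @[n --> \oo] --> c%:E * \int[nu]_y f y.
  exact: cvgeZl.
under eq_fun do rewrite -nnsfun_case.
by move=> hc; rewrite -(cvg_lim _ hmu)// (cvg_lim _ hc).
Qed.

End WeightedComposition.

Section Independence.
Context {R : realType} {disp : measure_display} {Omega : measurableType disp}.
Variables (P : probability Omega R) (n d : nat) (X : 'I_n -> {RV P >-> d.-tuple R}).
Hypothesis Xindep : mutually_independent X.
Variables (f : 'I_n -> d.-tuple R -> R) (e : 'I_n -> R).
Hypotheses (mf : forall i, measurable_fun setT (f i)) (f0 : forall i y, 0 <= f i y).
Hypothesis fe : forall i, (\int[P]_omega (f i (X i omega))%:E = (e i)%:E)%E.

(* The functions are exchanged for the indicators one at a time: fixing all the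
   other factors turns the expectation into a multiple of the law of one [X i]. *)
Lemma expectation_prod : (\int[P]_omega (\prod_i f i (X i omega))%:E = (\prod_i e i)%:E)%E.
Proof.
have mX i : measurable_fun setT (X i) by exact: measurable_funPT.
have e0 i : 0 <= e i.
  by rewrite -lee_fin -fe; apply: integral_ge0 => omega _; rewrite lee_fin.
have PX i B : measurable B -> P (X i @^-1` B) \is a fin_num.
  by move=> mB; apply: fin_num_measure; rewrite -[X in measurable X]setTI; exact: mX.
suff H (m : nat) : (m <= n)%N -> forall B : 'I_n -> set (d.-tuple R),
    (forall i, measurable (B i)) ->
    (\int[P]_omega (\prod_(i < n) (if (i < m)%N then f i (X i omega)
                                 else \1_(B i) (X i omega)))%:E =
    (\prod_(i < n) (if (i < m)%N then e i else fine (P (X i @^-1` B i))))%:E)%E.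
  have := H n (leqnn n) (fun=> setT) (fun=> measurableT).
  rewrite (eq_bigr e) => [<-|i _]; last by rewrite ltn_ord.
  by apply: eq_integral => omega _; congr EFin; apply: eq_bigr => i _; rewrite ltn_ord.
elim: m => [_ B mB|m IH mn B mB].
  transitivity (\int[P]_omega (\1_(\bigcap_i (X i @^-1` B i)) omega)%:E)%E.
    apply: eq_integral => omega _; congr EFin; rewrite !indicE.
    case: (boolP (omega \in _)) => [|].
      rewrite inE => h; rewrite big1// => i _ /=.
      by rewrite indicE mem_set//; exact: h.
    move=> /negP h.
    have [i hi] : exists i, ~ B i (X i omega).
      by apply/existsNP => hh; apply: h; rewrite inE => i _; exact: hh.
    by rewrite (bigD1 i)//= indicE memNset// mul0r.
  have mXB i : measurable (X i @^-1` B i).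
    by rewrite -[X in measurable X]setTI; exact: mX.
  rewrite integral_indic// ?setIT; last first.
    by apply: fin_bigcap_measurable => //; exact: finite_finset.
  transitivity (\prod_i P (X i @^-1` B i))%E; first exact: Xindep.
  rewrite (big_morph EFin (fun x y => EFinM x y) erefl).
  by apply: eq_bigr => i _; rewrite fineK// PX.
pose i0 := Ordinal mn.
have i0E (i : 'I_n) : i != i0 -> (i < m.+1)%N = (i < m)%N.
  by move=> ii0; rewrite ltnS leq_eqVlt -[(i == m :> nat)]/(i == i0) (negbTE ii0).
pose F (i : 'I_n) omega := if (i < m)%N then f i (X i omega) else \1_(B i) (X i omega).
pose H omega := \prod_(i < n | i != i0) F i omega.
pose c := \prod_(i < n | i != i0) (if (i < m)%N then e i else fine (P (X i @^-1` B i))).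
have F0 i omega : 0 <= F i omega by rewrite /F; case: ifP => // _; rewrite indicE.
have mF i : measurable_fun setT (F i).
  rewrite /F; case: (i < m)%N; exact: (measurableT_comp _ (mX i)).
have mH : measurable_fun setT H.
  by rewrite /H; under eq_fun do rewrite -big_filter; exact: measurable_prod.
have H0 omega : 0 <= H omega by apply: prodr_ge0.
have key := @integral_weighted_comp R _ _ Omega _ P (pushforward P (X i0)) H (X i0) c
  mH H0 (mX i0) _ (EFin \o f i0).
transitivity (\int[P]_omega ((H omega)%:E * (EFin \o f i0) (X i0 omega)))%E.
  apply: eq_integral => omega _; rewrite (bigD1 i0)//= ltnS leqnn mulrC EFinM.
  by congr (_%:E * _)%E; apply: eq_bigr => i ii0; rewrite i0E.
rewrite key//; first last.
- by move=> y; rewrite lee_fin f0.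
- exact/measurable_EFinP.
(* Slot [i0] still holds an indicator at stage [m], so the induction hypothesis with [B'] in that
   slot is the required weighted law. *)
- move=> B' mB'; pose B2 i := if i == i0 then B' else B i.
  have mB2 i : measurable (B2 i) by rewrite /B2; case: ifP.
  have := IH (ltnW mn) B2 mB2; rewrite [X in _ = X%:E](bigD1 i0)//= ltnn.
  rewrite /B2 eqxx /pushforward /=.
  have -> : \prod_(i < n | i != i0) (if (i < m)%N then e i else
      fine (P (X i @^-1` (if i == i0 then B' else B i)))) = c.
    by apply: eq_bigr => i /negbTE ->.
  rewrite mulrC EFinM fineK ?PX// => <-.
  apply: eq_integral => omega _; congr EFin; rewrite (bigD1 i0)//= ltnn eqxx mulrC.
  by congr (_ * _); apply: eq_bigr => i /negbTE ii0; rewrite /F ii0.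
- rewrite ge0_integral_pushforward//; last 2 first.
  + exact/measurable_EFinP.
  + by move=> y _; rewrite /= lee_fin f0.
  rewrite preimage_setT fe -EFinM (bigD1 i0)//= ltnS leqnn mulrC.
  by congr (_ * _)%:E; apply: eq_bigr => i ii0; rewrite i0E.
Qed.

End Independence.

(** * Gaussian quadratic forms *)

Section ScalarBounds.
Context {R : realType}.

Lemma expR_sqr_ge (x : R) : 0 <= x -> (1 + x / 2) ^+ 2 <= expR x.
Proof.
move=> x0; rewrite [in leRHS](_ : x = x / 2 * 2%:R) ?expRM_natr ?divfK//.
rewrite ler_pXn2r ?nnegrE ?expR_ge0 ?expR_ge1Dx//.
by rewrite addr_ge0// divr_ge0.
Qed.

(** Lets second moments be read off from exponential moments. *)
Lemma sqr_le_expR (x : R) : x ^+ 2 <= 4 * (expR x + expR (- x)).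
Proof.
wlog x0 : x / 0 <= x.
  move=> h; have [|/ltW x0] := leP 0 x; first exact: h.
  by have := h (- x); rewrite sqrrN opprK [expR _ + _]addrC oppr_ge0; apply.
have := expR_sqr_ge x0; have := expR_ge0 (- x); move: (expR _) (expR _) => a b; nra.
Qed.

(** The left side is the expectation of [expR (y * (Z ^+ 2 - 1))] for a standard normal [Z]. *)
Lemma chi_sqr_mgf_bound (y : R) : `|y| <= 8^-1 ->
  expR (- y) * (Num.sqrt (1 - 2 * y))^-1 <= expR (2 * y ^+ 2).
Proof.
move=> y8; have yl : - 8^-1 <= y by have := ler_norm (- y); rewrite normrN; lra.
have yu : y <= 8^-1 by have := ler_norm y; lra.
have y1 : 0 < 1 - 2 * y by lra.
rewrite ler_pdivrMr ?sqrtr_gt0// -(@ler_pXn2r _ 2)// ?nnegrE ?mulr_ge0 ?expR_ge0 ?sqrtr_ge0//.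
rewrite exprMn sqr_sqrtr ?(ltW y1)// -!expRM_natr.
pose t := 2 * y + 4 * y ^+ 2.
suff : 1 <= expR t * (1 - 2 * y).
  move=> h; have -> : 2 * y ^+ 2 * 2%:R = - y * 2%:R + t by rewrite /t; ring.
  by rewrite expRD -mulrA ler_peMr// expR_ge0.
(* Since [(1 + t) * (1 - 2 * y) = 1 - 8 * y ^+ 3], the linear bound on [expR t] suffices only for
   nonpositive [y]; for positive [y] the squared bound [expR_sqr_ge] is used. *)
have [y0|y0] := leP 0 y.
  have t0 : 0 <= t by rewrite /t addr_ge0 ?mulr_ge0 ?sqr_ge0.
  apply: (@le_trans _ _ ((1 + t / 2) ^+ 2 * (1 - 2 * y))).
    have -> : (1 + t / 2) ^+ 2 * (1 - 2 * y) =
        1 + y ^+ 2 * (1 - 6 * y - 4 * y ^+ 2 - 8 * y ^+ 3) by rewrite /t; field.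
    rewrite lerDl mulr_ge0 ?sqr_ge0//.
    have y2 : y ^+ 2 <= y / 8 by rewrite expr2 ler_wpM2l.
    have y3 : y ^+ 3 <= y / 8.
      by rewrite exprS ler_wpM2l//; lra.
    lra.
  by rewrite ler_wpM2r ?(ltW y1)// expR_sqr_ge.
apply: (@le_trans _ _ ((1 + t) * (1 - 2 * y))); last first.
  by rewrite ler_wpM2r ?(ltW y1)// expR_ge1Dx.
have -> : (1 + t) * (1 - 2 * y) = 1 + y ^+ 2 * (- y) * 8 by rewrite /t; ring.
rewrite lerDl; apply: mulr_ge0 => //.
by apply: mulr_ge0; rewrite ?sqr_ge0// oppr_ge0 ltW.
Qed.

Lemma gaussian_exponentD (v theta x : R) : v != 0 -> 1 - 2 * theta * v != 0 ->
  - x ^+ 2 / (v *+ 2) + theta * x ^+ 2 =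
  - x ^+ 2 / (v / (1 - 2 * theta * v) *+ 2).
Proof. by move=> v0 u0; field; rewrite v0 u0. Qed.

End ScalarBounds.

Definition lin_form {R : realType} d (a : 'cV[R]_d) (y : d.-tuple R) : R :=
  \sum_j a j 0 * tnth y j.

Lemma measurable_lin_form {R : realType} d (a : 'cV[R]_d) :
  measurable_fun setT (lin_form a).
Proof.
apply: measurable_sum => j; apply: measurable_funM => //.
exact: measurable_tnth.
Qed.

Section Gaussian.
Context {R : realType} {disp : measure_display} {Omega : measurableType disp}.
Variables (P : probability Omega R).

(** Tilting the density by the exponential gives [k] times the centred normal density of variance
    [v / (1 - 2 * theta * v)], and [k] is the integral. *)
Lemma integral_normal_expR_sqr (v theta : R) : 0 < v -> 2 * theta * v < 1 ->
  (\int[normal_prob 0 (Num.sqrt v)]_x (expR (theta * x ^+ 2))%:E =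
   ((Num.sqrt (1 - 2 * theta * v))^-1)%:E)%E.
Proof.
move=> v0 tv1; have u0 : 0 < 1 - 2 * theta * v by rewrite subr_gt0.
have sv0 : Num.sqrt v != 0 by rewrite sqrtr_eq0 -ltNge.
pose k := (Num.sqrt (1 - 2 * theta * v))^-1.
pose tau := Num.sqrt v * k.
have k0 : 0 < k by rewrite invr_gt0 sqrtr_gt0.
have tau0 : tau != 0 by rewrite mulf_neq0// lt0r_neq0.
have mid : measurable_fun setT (@idfun R) by exact: measurable_id.
have mf : measurable_fun setT (fun x : R => (expR (theta * x ^+ 2))%:E).
  apply/measurable_EFinP; apply: (measurableT_comp (@measurable_expR R)).
  apply: measurable_funM => //; exact: measurable_funX.
have key := @integral_weighted_comp R _ _ _ _ (@lebesgue_measure R)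
  (normal_prob 0 (Num.sqrt v)) (normal_pdf 0 (Num.sqrt v)) idfun 1
  (measurable_normal_pdf 0 (Num.sqrt v)) (normal_pdf_ge0 0 (Num.sqrt v)) mid _
  _ mf (fun y => _).
rewrite -[LHS]mul1e -key; first last.
- by move=> y; rewrite lee_fin expR_ge0.
- move=> B mB; rewrite mul1e.
  rewrite -[RHS]/(\int[lebesgue_measure]_(x in B) (normal_pdf 0 (Num.sqrt v) x)%:E)%E.
  rewrite [RHS]integral_mkcond; apply: eq_integral => x _; rewrite patchE indicE; by case: ifP => h; rewrite ?mulr1 ?mulr0.
transitivity (\int[lebesgue_measure]_x (k%:E * (normal_pdf 0 tau x)%:E))%E.
  apply: eq_integral => x _; rewrite -!EFinM !normal_pdfE//; congr EFin.
  rewrite /normal_peak /normal_fun -mulrA -expRD [in RHS]mulrA.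
  have tau2 : tau ^+ 2 = v / (1 - 2 * theta * v).
    by rewrite exprMn exprVn !sqr_sqrtr// ltW.
  congr (_ * expR _); last first.
    by rewrite tau2 sqr_sqrtr ?(ltW v0)// !subr0 gaussian_exponentD// lt0r_neq0.
  rewrite tau2 -[LHS]mul1r -[X in X = _]/(1 * _).
  have vp : 0 <= v * pi *+ 2 by rewrite mulrn_wge0// mulr_ge0 ?(ltW v0) ?pi_ge0.
  have -> u : v * u * pi *+ 2 = u * (v * pi *+ 2).
    by rewrite mulrnAr [v * u]mulrC -mulrA.
  rewrite sqrtrM ?invr_ge0 ?(ltW u0)// invfM sqrtrV ?(ltW u0)// invrK mulrA.
  rewrite sqr_sqrtr ?(ltW v0)// mulVf ?mul1r// sqrtr_eq0 -ltNge//.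
rewrite ge0_integralZl_EFin ?(ltW k0)//.
- by rewrite integral_normal_pdf mule1.
- by move=> x _; rewrite lee_fin normal_pdf_ge0.
- by apply/measurable_EFinP; exact: measurable_normal_pdf.
Qed.

Lemma gaussian_expR_sqr d (Sigma : 'M[R]_d) (X : {RV P >-> d.-tuple R}) a theta :
  posdef Sigma -> gaussian_rv Sigma X -> a != 0 -> 2 * theta * qf Sigma a < 1 ->
  (\int[P]_omega (expR (theta * lin_form a (X omega) ^+ 2))%:E =
   ((Num.sqrt (1 - 2 * theta * qf Sigma a))^-1)%:E)%E.
Proof.
move=> Sp gX a0 tv; have v0 : 0 < qf Sigma a by apply: Sp.2.
rewrite -integral_normal_expR_sqr//.
have mU : measurable_fun setT (fun omega => lin_form a (X omega)).
  apply: (measurableT_comp (measurable_lin_form a)); exact: measurable_funPT.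
have mf : measurable_fun setT (fun x : R => (expR (theta * x ^+ 2))%:E).
  apply/measurable_EFinP; apply: (measurableT_comp (@measurable_expR R)).
  apply: measurable_funM => //; exact: measurable_funX.
have key := @integral_weighted_comp R _ _ _ _ P
  (normal_prob 0 (Num.sqrt (qf Sigma a))) (fun=> 1) _ 1
  (measurable_cst _) (fun=> ler01) mU _ _ mf (fun y => _).
rewrite -[RHS]mul1e -key; first last.
- by move=> y; rewrite lee_fin expR_ge0.
- move=> B mB; rewrite mul1e.
  transitivity (P ((fun omega => lin_form a (X omega)) @^-1` B)); last exact: (gX a a0 B mB).
  rewrite -[in RHS](setIT (_ @^-1` _)) -integral_indic//; last first.
    by rewrite -[X in measurable X]setTI; exact: mU.
  by apply: eq_integral => omega _; rewrite mul1r.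
by apply: eq_integral => omega _; rewrite mul1e.
Qed.

End Gaussian.

(** * Exponential moments of quadratic forms of the sample covariance *)

Section Concentration.
Context {R : realType} {disp : measure_display} {Omega : measurableType disp}.
Variables (P : probability Omega R) (n d : nat) (Sigma : 'M[R]_d).
Variables (X : 'I_n -> {RV P >-> d.-tuple R}).
Hypotheses (n0 : (0 < n)%N) (Sp : posdef Sigma) (gX : iid_gaussian Sigma X).

(** The quadratic form of the sample covariance minus [Sigma], evaluated at [a]. *)
Definition quadratic_dev (a : 'cV[R]_d) (omega : Omega) : R :=
  n%:R^-1 * (\sum_k lin_form a (X k omega) ^+ 2) - qf Sigma a.

Lemma measurable_quadratic_dev a : measurable_fun setT (quadratic_dev a).
Proof.
apply: measurable_funB => //; apply: measurable_funM => //.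
apply: measurable_sum => k; apply: measurable_funX.
apply: (measurableT_comp (measurable_lin_form a)); exact: measurable_funPT.
Qed.

Lemma quadratic_dev_mgf a theta : qf Sigma a <= 4 -> `|theta| <= n%:R / 32 ->
  (\int[P]_omega (expR (theta * quadratic_dev a omega))%:E <= (expR (32 * theta ^+ 2 / n%:R))%:E)%E.
Proof.
move=> a4 tn; have nR : 0 < n%:R :> R by rewrite ltr0n.
(* [gaussian_rv] says nothing about [a = 0], yet this case occurs: [pair_vec Sigma true i i] is
   0. *)
have [->|a0] := eqVneq a 0.
  rewrite (eq_integral (cst 1%E)) => [|omega _]; last first.
    rewrite /quadratic_dev big1 => [|k _]; last first.
      by rewrite /lin_form big1 ?expr0n// => j _; rewrite mxE mul0r.
    rewrite (_ : qf Sigma 0 = 0); last by rewrite /qf mulmx0 mxE.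
    by rewrite mulr0 subr0 mulr0 expR0.
  have -> : (\int[P]_omega cst 1%E omega = 1)%E.
    by rewrite integral_cst// mul1e; exact: probability_setT.
  rewrite lee_fin -[leLHS]expR0 ler_expR.
  by rewrite divr_ge0 ?(ltW nR)// mulr_ge0// sqr_ge0.
set v := qf Sigma a in a4; have v0 : 0 < v by apply: Sp.2.
pose t := theta / n%:R; pose y := t * v.
have y8 : `|y| <= 8^-1.
  rewrite /y /t !normrM (ger0_norm (ltW v0)) normfV (ger0_norm (ltW nR)).
  have : `|theta| / n%:R <= 32^-1 by rewrite ler_pdivrMr// mulrC.
  have := normr_ge0 theta; have : 0 <= `|theta| / n%:R by rewrite divr_ge0// ltW.
  by move: (_ / _) => z; nra.
have y1 : 2 * t * v < 1 by have := ler_norm y; rewrite /y in y8 *; lra.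
pose f (i : 'I_n) (x : d.-tuple R) := expR (- y) * expR (t * lin_form a x ^+ 2).
have mf i : measurable_fun setT (f i).
  apply: measurable_funM => //; apply: (measurableT_comp (@measurable_expR R)).
  apply: measurable_funM => //; apply: measurable_funX; exact: measurable_lin_form.
have f0 i x : 0 <= f i x by rewrite mulr_ge0 ?expR_ge0.
have fe i : (\int[P]_omega (f i (X i omega))%:E =
    (expR (- y) * (Num.sqrt (1 - 2 * t * v))^-1)%:E)%E.
  under eq_integral do rewrite EFinM.
  rewrite ge0_integralZl_EFin ?expR_ge0//.
  - by rewrite (gaussian_expR_sqr Sp (gX.2 i)).
  - apply/measurable_EFinP; apply: (measurableT_comp (@measurable_expR R)).
    apply: measurable_funM => //; apply: measurable_funX.
    by apply: (measurableT_comp (measurable_lin_form a)); exact: measurable_funPT.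
have -> : (\int[P]_omega (expR (theta * quadratic_dev a omega))%:E =
    \int[P]_omega (\prod_i f i (X i omega))%:E)%E.
  apply: eq_integral => omega _; congr EFin; rewrite /f big_split /= -!expR_sum -expRD.
  congr expR; rewrite sumr_const card_ord -mulr_natr -mulr_sumr /quadratic_dev /y /t -/v.
  by field; exact: lt0r_neq0.
rewrite (expectation_prod gX.1 mf f0 fe) lee_fin prodr_const card_ord.
have -> : 2 * t * v = 2 * y by rewrite /y mulrA.
apply: (@le_trans _ _ (expR (2 * y ^+ 2) ^+ n)).
  by apply: lerXn2r; rewrite ?nnegrE ?mulr_ge0 ?expR_ge0 ?invr_ge0 ?sqrtr_ge0// chi_sqr_mgf_bound.
rewrite -expRM_natr ler_expR /y /t.
have -> : 2 * (theta / n%:R * v) ^+ 2 * n%:R = 2 * v ^+ 2 * (theta ^+ 2 / n%:R).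
  by field; exact: lt0r_neq0.
rewrite -[leRHS]mulrA ler_wpM2r ?divr_ge0 ?sqr_ge0 ?(ltW nR)//.
by nra.
Qed.

End Concentration.

(** * Correlation matrices *)

Section Correlation.
Context {R : realType}.

Lemma mxB_entry m n (A B : 'M[R]_(m, n)) i j : (A - B) i j = A i j - B i j.
Proof. by rewrite mxE [X in _ + X]mxE. Qed.

Lemma invmx_diag n (r : 'rV[R]_n) : (forall i, r 0 i != 0) ->
  invmx (diag_mx r) = diag_mx (\row_i (r 0 i)^-1).
Proof.
move=> r0; set D := diag_mx (\row_i _).
have rD : diag_mx r *m D = 1%:M.
  rewrite mulmx_diag; apply/matrixP => i j; rewrite !mxE; case: eqP => // ->.
  by rewrite mulr1n mulfV.
have ru : diag_mx r \in unitmx by case/mulmx1_unit: rD.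
by rewrite -[LHS]mulmx1 -rD mulKmx.
Qed.

Lemma correlationE n (A : 'M[R]_n) i j : (forall i, 0 < A i i) ->
  correlation A i j = A i j / (Num.sqrt (A i i) * Num.sqrt (A j j)).
Proof.
move=> A0; rewrite /correlation /std_diag invmx_diag; last first.
  by move=> k; rewrite mxE sqrtr_eq0 -ltNge.
by rewrite mul_mx_diag mxE mul_diag_mx !mxE invfM mulrAC [RHS]mulrC -mulrA.
Qed.

Lemma posdef_diag_gt0 n (A : 'M[R]_n) i : posdef A -> 0 < A i i.
Proof.
move=> [_ Ap]; have := Ap (delta_mx i 0); rewrite trmx_delta -rowE -colE !mxE; apply.
by apply/eqP => /matrixP/(_ i 0); rewrite !mxE !eqxx => /eqP; rewrite oner_eq0.
Qed.

Lemma posdef_correlation n (A : 'M[R]_n) : posdef A -> posdef (correlation A).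
Proof.
move=> Ap; have A0 i := posdef_diag_gt0 i Ap.
have Dt : (std_diag A)^T = std_diag A by rewrite tr_diag_mx.
have Du : std_diag A \in unitmx.
  rewrite unitmxE unitfE det_diag; apply/prodf_neq0 => i _.
  by rewrite mxE sqrtr_eq0 -ltNge.
rewrite /correlation -{1}Dt -trmx_inv; apply: posdef_congr => //.
by rewrite unitmx_inv.
Qed.

Lemma qf_pair n (A : 'M[R]_n) i j x y : A^T = A ->
  qf A (x *: delta_mx i 0 + y *: delta_mx j 0) =
  x ^+ 2 * A i i + 2 * (x * y) * A i j + y ^+ 2 * A j j.
Proof.
move=> At; rewrite /qf.
have -> : (x *: delta_mx i 0 + y *: delta_mx j 0 : 'cV[R]_n)^T =
    x *: delta_mx 0 i + y *: delta_mx 0 j.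
  by rewrite linearD !linearZ /= !trmx_delta.
rewrite !mulmxDl !mulmxDr -!(scalemxAl, scalemxAr) -!rowE -!colE !mxE.
have -> : A j i = A i j by rewrite -[in LHS]At mxE.
by ring.
Qed.

(** Polarization vectors in standardized coordinates, the sign being given by [b]; the
    standardization keeps their quadratic form below 4 whatever the variances. *)
Definition pair_vec n (A : 'M[R]_n) (b : bool) i j : 'cV[R]_n :=
  (Num.sqrt (A i i))^-1 *: delta_mx i 0 +
  ((-1) ^+ b * (Num.sqrt (A j j))^-1) *: delta_mx j 0.

Lemma qf_pair_vec n (A : 'M[R]_n) b i j : posdef A ->
  qf A (pair_vec A b i j) = 2 + 2 * (-1) ^+ b * correlation A i j.
Proof.
move=> Ap; have A0 k := posdef_diag_gt0 k Ap.
rewrite qf_pair ?Ap.1// correlationE// exprMn sqrr_sign mul1r !exprVn !sqr_sqrtr ?ltW//.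
by rewrite !mulVf ?gt_eqF// invfM; ring.
Qed.

Lemma correlation_le1 n (A : 'M[R]_n) i j : posdef A -> `|correlation A i j| <= 1.
Proof.
move=> Ap; have h b := posdef_qf_ge0 (pair_vec A b i j) Ap.
have := h true; have := h false; rewrite !qf_pair_vec// expr0 expr1 ler_norml.
by move=> h1 h2; apply/andP; split; lra.
Qed.

Lemma qf_pair_vec_le4 n (A : 'M[R]_n) b i j : posdef A ->
  qf A (pair_vec A b i j) <= 4.
Proof.
move=> Ap; rewrite qf_pair_vec//; have := correlation_le1 i j Ap; rewrite ler_norml.
by case/andP => h1 h2; case: b; rewrite ?expr0 ?expr1; lra.
Qed.

Lemma correlation_diag n (A : 'M[R]_n) i : (forall i, 0 < A i i) -> correlation A i i = 1.
Proof.
by move=> A0; rewrite correlationE// -expr2 sqr_sqrtr ?(ltW (A0 i))// divff// gt_eqF.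
Qed.

(** Effect of dividing by estimated standard deviations: [e] is the deviation of an entry, [x] and
    [y] are those of the two diagonal entries that normalize it. *)
Lemma normalize_perturb (c e x y : R) : `|c| <= 1 -> `|x| <= 2^-1 -> `|y| <= 2^-1 ->
  `|(c + e) / (Num.sqrt (1 + x) * Num.sqrt (1 + y)) - c| <= 2 * (`|e| + `|x| + `|y|).
Proof.
move=> c1 x2 y2; rewrite !ler_norml in x2 y2.
have /andP[xl xu] := x2; have /andP[yl yu] := y2.
rewrite -sqrtrM; last by lra.
set q2 := (1 + x) * (1 + y); set q := Num.sqrt q2.
have q20 : 4^-1 <= q2.
  have -> : 4^-1 = 2^-1 * 2^-1 :> R by rewrite -invfM -natrM.
  by rewrite /q2; apply: ler_pM; lra.
have q0 : 0 < q by rewrite sqrtr_gt0; apply: lt_le_trans q20; lra.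
have qq : q ^+ 2 = q2 by rewrite sqr_sqrtr//; apply: le_trans q20; lra.
have qh : 2^-1 <= q by have := sqrtr_ge0 q2; nra.
have q1 : `|1 - q| <= `|x| + `|y|.
  have : `|1 - q| * (1 + q) <= (`|x| + `|y|) * (1 + q).
    have -> : `|1 - q| * (1 + q) = `|x + y + x * y|.
      rewrite -[1 + q]ger0_norm; last by lra.
      by rewrite -normrM -normrN; congr `|_|; move: qq; rewrite /q2; lra.
    apply: (@le_trans _ _ ((`|x| + `|y|) * (1 + 2^-1))); last first.
      by apply: ler_wpM2l; [exact: addr_ge0|lra].
    apply: le_trans (ler_normD _ _) _; rewrite normrM.
    have := ler_normD x y; have : `|x| <= 2^-1 by rewrite ler_norml x2.
    by have := normr_ge0 x; have := normr_ge0 y; move: `|x| `|y| => u v; nra.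
  by rewrite ler_pM2r//; lra.
have -> : (c + e) / q - c = (e + c * (1 - q)) / q by field; rewrite gt_eqF.
rewrite normrM normfV (gtr0_norm q0) ler_pdivrMr//.
have : `|e + c * (1 - q)| <= `|e| + `|x| + `|y|.
  apply: le_trans (ler_normD _ _) _; rewrite -addrA lerD2l normrM.
  by apply: le_trans q1; rewrite ler_piMl.
have : 0 <= `|e| + `|x| + `|y| by rewrite !addr_ge0.
by move: (_ + _) `|_| => u v; nra.
Qed.

End Correlation.

(** * Concentration of the sample correlation matrix *)

Section Markov.
Context {R : realType} {disp : measure_display} {Omega : measurableType disp}.
Variables (P : probability Omega R).

Lemma measurable_ge_fun (g : Omega -> R) c : measurable_fun setT g ->
  measurable [set omega | c <= g omega].
Proof.
move=> mg; rewrite (_ : [set _ | _] = g @^-1` `[c, +oo[).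
  by rewrite -[X in measurable X]setTI; exact: mg.
by apply/seteqP; split => omega /=; rewrite in_itv /= andbT.
Qed.

Lemma markov_bound (g : Omega -> R) (k c : R) : measurable_fun setT g ->
  (forall omega, 0 <= g omega) -> (\int[P]_omega (g omega)%:E <= k%:E)%E -> 0 < c ->
  (P [set omega | c <= g omega]%R <= (k / c)%:E)%E.
Proof.
move=> mg g0 gk c0; set A := [set _ | _].
have mA : measurable A by exact: measurable_ge_fun.
have h : (c%:E * P A <= k%:E)%E.
  apply: le_trans gk; rewrite -[A]setIT -integral_indic// -ge0_integralZl_EFin ?(ltW c0)//.
  - apply: ge0_le_integral => //.
    + by move=> omega _; rewrite -EFinM lee_fin mulr_ge0 ?(ltW c0).
    + by apply: emeasurable_funM => //; exact/measurable_EFinP/measurable_indic.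
    + exact/measurable_EFinP.
    + move=> omega _; rewrite -EFinM lee_fin indicE.
      case: (boolP (omega \in A)) => [|_]; last by rewrite mulr0.
      by rewrite inE mulr1.
  - by exact/measurable_EFinP/measurable_indic.
have PA : P A \is a fin_num by exact: fin_num_measure.
move: h; rewrite -[P A]fineK// -EFinM !lee_fin => h.
by rewrite ler_pdivlMr// mulrC.
Qed.

Lemma measure_union_le (I : finType) (A : I -> set Omega) k :
  (forall i, measurable (A i)) -> (forall i, (P (A i) <= k%:E)%E) ->
  (P (\big[setU/set0]_i A i) <= (#|I|%:R * k)%:E)%E.
Proof.
move=> mA PA.
suff : measurable (\big[setU/set0]_i A i) /\
    (P (\big[setU/set0]_i A i) <= (\sum_(i : I) k)%:E)%E.
  by rewrite sumr_const mulr_natl => -[].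
elim/big_rec2 : _ => [|i x y _ [mx xy]]; first by rewrite measure0.
split; first exact: measurableU.
apply: le_trans (measureU2 _ _ _) _ => //.
by rewrite EFinD; exact: (leeD (PA i) xy).
Qed.

End Markov.

Section Concentration.
Context {R : realType} {disp : measure_display} {Omega : measurableType disp}.
Variables (P : probability Omega R) (n d : nat) (Sigma : 'M[R]_d).
Variables (X : 'I_n -> {RV P >-> d.-tuple R}).
Hypotheses (n0 : (0 < n)%N) (Sp : posdef Sigma) (gX : iid_gaussian Sigma X).

Let nR : 0 < n%:R :> R. Proof. by rewrite ltr0n. Qed.

Local Notation qdev := (quadratic_dev Sigma X).

Lemma qdev_cosh_mgf a theta : qf Sigma a <= 4 -> `|theta| <= n%:R / 32 ->
  (\int[P]_omega (expR (theta * qdev a omega) + expR (- (theta * qdev a omega)))%:E <=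
   (2 * expR (32 * theta ^+ 2 / n%:R))%:E)%E.
Proof.
move=> a4 tn; under eq_integral do rewrite EFinD.
have me t : measurable_fun setT (fun omega => (expR (t * qdev a omega))%:E).
  apply/measurable_EFinP; apply: (measurableT_comp (@measurable_expR R)).
  by apply: measurable_funM => //; exact: measurable_quadratic_dev.
rewrite ge0_integralD//.
- rewrite mulr_natl mulr2n EFinD; apply: leeD; first exact: quadratic_dev_mgf.
  under eq_integral do rewrite -mulNr.
  by rewrite -[theta ^+ 2]sqrrN; apply: quadratic_dev_mgf => //; rewrite normrN.
- by under eq_fun do rewrite -mulNr; exact: me.
Qed.

Let measurable_cosh a theta : measurable_fun setT
  (fun omega => expR (theta * qdev a omega) + expR (- (theta * qdev a omega))).
Proof.
have me t : measurable_fun setT (fun omega => expR (t * qdev a omega)).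
  apply: (measurableT_comp (@measurable_expR R)).
  by apply: measurable_funM => //; exact: measurable_quadratic_dev.
by apply: measurable_funD; [exact: me|under eq_fun do rewrite -mulNr; exact: me].
Qed.

Lemma qdev_tail a t : qf Sigma a <= 4 -> 0 <= t <= 2 ->
  (P [set omega | t <= `|qdev a omega|]%R <= (2 * expR (- (n%:R * t ^+ 2 / 128)))%:E)%E.
Proof.
(* The minimizer of [32 * theta ^+ 2 / n - theta * t]; it stays within the range [n / 32] because
   [t <= 2]. *)
move=> a4 /andP[t0 t2]; pose theta := n%:R * t / 64.
have th0 : 0 <= theta by rewrite divr_ge0// mulr_ge0// ltW.
have tn : `|theta| <= n%:R / 32.
  rewrite ger0_norm// /theta (_ : n%:R / 32 = n%:R * 2 / 64); last by field.
  by rewrite ler_wpM2r// ler_wpM2l// ltW.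
have := markov_bound (measurable_cosh a theta)
  (fun omega => addr_ge0 (expR_ge0 _) (expR_ge0 _)) (qdev_cosh_mgf a4 tn)
  (expR_gt0 (theta * t)).
rewrite -expRN -mulrA -expRD.
have -> : 32 * theta ^+ 2 / n%:R + - (theta * t) = - (n%:R * t ^+ 2 / 128).
  by rewrite /theta; field; exact: lt0r_neq0.
apply: le_trans; apply: le_measure; rewrite ?inE.
- apply: measurable_ge_fun; apply: measurableT_comp => //; exact: measurable_quadratic_dev.
- by apply: measurable_ge_fun; exact: measurable_cosh.
move=> omega /= tq; have [q0|/ltW q0] := leP 0 (qdev a omega).
  rewrite ger0_norm// in tq; apply: ler_wpDr; first exact: expR_ge0.
  by rewrite ler_expR ler_wpM2l.
rewrite ler0_norm// in tq; apply: ler_wpDl; first exact: expR_ge0.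
by rewrite ler_expR -mulrN ler_wpM2l.
Qed.

Lemma qdev_second_moment a : qf Sigma a <= 4 ->
  (\int[P]_omega (qdev a omega ^+ 2)%:E <= (128 ^+ 2 / n%:R)%:E)%E.
Proof.
(* At this scale the exponential moment is bounded by a constant, while [theta ^- 2] has the wanted
   order 1/n. *)
move=> a4; pose theta := Num.sqrt (n%:R : R) / 32.
have sn0 : 0 < Num.sqrt (n%:R : R) by rewrite sqrtr_gt0.
have th0 : 0 < theta by rewrite divr_gt0.
have th2 : theta ^+ 2 = n%:R / 32 ^+ 2.
  by rewrite exprMn exprVn sqr_sqrtr ?ler0n.
have tn : `|theta| <= n%:R / 32.
  rewrite gtr0_norm// /theta ler_wpM2r// -[leRHS]sqr_sqrtr ?ler0n//.
  rewrite expr2 ler_peMr ?(ltW sn0)// -[leLHS]sqrtr1 ler_wsqrtr// ler1n.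
  exact: n0.
have h := qdev_cosh_mgf a4 tn.
apply: (@le_trans _ _ (\int[P]_omega ((64 ^+ 2 / n%:R)%:E *
   (expR (theta * qdev a omega) + expR (- (theta * qdev a omega)))%:E))%E).
  apply: ge0_le_integral => //.
  - by move=> omega _; rewrite lee_fin sqr_ge0.
  - apply/measurable_EFinP; apply: measurable_funX; exact: measurable_quadratic_dev.
  - apply: emeasurable_funM => //; exact/measurable_EFinP/measurable_cosh.
  - move=> omega _; rewrite -EFinM lee_fin.
    have := sqr_le_expR (theta * qdev a omega); rewrite exprMn th2.
    rewrite mulrAC ler_pdivrMr// => hh.
    rewrite mulrAC ler_pdivlMr// mulrC; lra.
rewrite ge0_integralZl_EFin; [|by []|by move=> omega _; rewrite lee_fin addr_ge0 ?expR_ge0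
  |exact/measurable_EFinP/measurable_cosh|by rewrite divr_ge0// ltW].
apply: (@le_trans _ _ ((64 ^+ 2 / n%:R)%:E * (2 * expR (32 * theta ^+ 2 / n%:R))%:E)%E).
  by apply: lee_wpmul2l => //; rewrite lee_fin divr_ge0// ltW.
rewrite -EFinM lee_fin th2.
have -> : 32 * (n%:R / 32 ^+ 2) / n%:R = 32^-1 :> R by field; exact: lt0r_neq0.
have : expR 32^-1 <= 2 :> R.
  have := expR_ge1Dx (- 32^-1 : R); rewrite expRN.
  have e0 := expR_gt0 (32^-1 : R).
  by move=> /(ler_wpM2r (ltW e0)); rewrite mulVf ?gt_eqF//; lra.
have ni : 0 < (n%:R : R)^-1 by rewrite invr_gt0.
by move: (expR _) (_^-1) ni => e v v0 e2; nra.
Qed.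

Definition pair_dev (b : bool) (p : 'I_d * 'I_d) (omega : Omega) : R :=
  qdev (pair_vec Sigma b p.1 p.2) omega.

Lemma all_pair_dev_prob t : 0 <= t <= 2 ->
  exists A : set Omega, [/\ measurable A,
    forall omega, A omega -> forall b p, `|pair_dev b p omega| <= t &
    ((1 - 4 * d%:R ^+ 2 * expR (- (n%:R * t ^+ 2 / 128)))%:E <= P A)%E].
Proof.
move=> t02; pose B (bp : bool * ('I_d * 'I_d)) :=
  [set omega | t <= `|pair_dev bp.1 bp.2 omega|].
have mB bp : measurable (B bp).
  apply: measurable_ge_fun; apply: measurableT_comp => //; exact: measurable_quadratic_dev.
have mU : measurable (\big[setU/set0]_bp B bp) by apply: bigsetU_measurable.
exists (~` (\big[setU/set0]_bp B bp)); split; first exact: measurableC.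
  move=> omega nB b p; rewrite leNgt; apply/negP => /ltW tb.
  by apply: nB; rewrite (bigD1 (b, p))//=; left.
rewrite probability_setC//.
have := measure_union_le mB (fun bp => qdev_tail (qf_pair_vec_le4 bp.1 bp.2.1 bp.2.2 Sp) t02).
rewrite !card_prod card_bool card_ord.
have Pf : P (\big[setU/set0]_bp B bp) \is a fin_num by exact: fin_num_measure.
rewrite -[P _]fineK// -EFinB !lee_fin; rewrite !natrM.
move: (fine _) (expR _) (d%:R) => x e y; lra.
Qed.

Lemma lin_form_pair_vec b i j (y : d.-tuple R) :
  lin_form (pair_vec Sigma b i j) y =
  (Num.sqrt (Sigma i i))^-1 * tnth y i + (-1) ^+ b * (Num.sqrt (Sigma j j))^-1 * tnth y j.
Proof.
rewrite /lin_form; under eq_bigr do rewrite !mxE mulrDl.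
rewrite big_split /=; congr (_ + _).
  rewrite (bigD1 i)//= eqxx mulr1 big1 ?addr0// => k /negbTE ki.
  by rewrite ki mulr0 mul0r.
rewrite (bigD1 j)//= eqxx mulr1 big1 ?addr0// => k /negbTE kj.
by rewrite kj mulr0 mul0r.
Qed.

Lemma sample_covE omega i j : sample_cov (fun k => X k omega) i j =
  n%:R^-1 * \sum_k tnth (X k omega) i * tnth (X k omega) j.
Proof.
rewrite mxE summxE; congr (_ * _); apply: eq_bigr => k _.
by rewrite mxE big_ord1 !mxE.
Qed.

(* By polarization, the deviation of the (i, j) entry of the sample covariance
   of the standardized variables. *)
Definition corr_dev (p : 'I_d * 'I_d) (omega : Omega) : R :=
  (pair_dev false p omega - pair_dev true p omega) / 4.

Lemma sample_cov_corr_dev omega i j : sample_cov (fun k => X k omega) i j =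
  Num.sqrt (Sigma i i) * Num.sqrt (Sigma j j) *
  (correlation Sigma i j + corr_dev (i, j) omega).
Proof.
have S0 k := posdef_diag_gt0 k Sp.
rewrite sample_covE /corr_dev /pair_dev /quadratic_dev !qf_pair_vec//=.
set u := Num.sqrt (Sigma i i); set v := Num.sqrt (Sigma j j).
have u0 : u != 0 by rewrite sqrtr_eq0 -ltNge.
have v0 : v != 0 by rewrite sqrtr_eq0 -ltNge.
have E : \sum_k lin_form (pair_vec Sigma false i j) (X k omega) ^+ 2 -
    \sum_k lin_form (pair_vec Sigma true i j) (X k omega) ^+ 2 =
    4 * (u * v)^-1 * \sum_k tnth (X k omega) i * tnth (X k omega) j.
  rewrite -sumrB mulr_sumr; apply: eq_bigr => k _.
  by rewrite !lin_form_pair_vec -/u -/v expr0 expr1; field; rewrite u0 v0.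
move: E; move: (\sum_k _) (\sum_k _) (\sum_k _) => a b c E.
have -> : c = b + 4 * (u * v)^-1 * a by rewrite -E addrC subrK.
rewrite expr0 expr1; field.
by rewrite u0 v0 lt0r_neq0.
Qed.

Lemma sample_corr_dev omega : (forall p, `|corr_dev p omega| <= 2^-1) ->
  (forall i, (sample_corr X omega - correlation Sigma) i i = 0) /\
  forall i j, `|(sample_corr X omega - correlation Sigma) i j| <=
    2 * (`|corr_dev (i, j) omega| + `|corr_dev (i, i) omega| + `|corr_dev (j, j) omega|).
Proof.
move=> dev2; have S0 k := posdef_diag_gt0 k Sp.
have d1 i : 0 < 1 + corr_dev (i, i) omega.
  by have := dev2 (i, i); rewrite ler_norml => /andP[]; lra.
have hat_diag i : sample_cov (fun k => X k omega) i i =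
    Sigma i i * (1 + corr_dev (i, i) omega).
  rewrite sample_cov_corr_dev correlation_diag// -expr2 sqr_sqrtr//.
  exact: ltW.
have hat0 i : 0 < sample_cov (fun k => X k omega) i i by rewrite hat_diag mulr_gt0.
split=> [i|i j].
  by rewrite mxB_entry /sample_corr !correlation_diag// subrr.
rewrite mxB_entry /sample_corr correlationE// !hat_diag sample_cov_corr_dev.
have u0 k : Num.sqrt (Sigma k k) != 0 by rewrite sqrtr_eq0 -ltNge.
rewrite !sqrtrM ?(ltW (S0 _))//.
set a := Num.sqrt (1 + _); set b := Num.sqrt (1 + _).
have a0 : a != 0 by rewrite sqrtr_eq0 -ltNge.
have b0 : b != 0 by rewrite sqrtr_eq0 -ltNge.
have -> : Num.sqrt (Sigma i i) * Num.sqrt (Sigma j j) *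
    (correlation Sigma i j + corr_dev (i, j) omega) /
    (Num.sqrt (Sigma i i) * a * (Num.sqrt (Sigma j j) * b)) =
    (correlation Sigma i j + corr_dev (i, j) omega) / (a * b).
  by field; rewrite a0 b0 !u0.
by apply: normalize_perturb; rewrite ?correlation_le1.
Qed.

Lemma measurable_corr_dev p : measurable_fun setT (corr_dev p).
Proof.
by apply: measurable_funM => //; apply: measurable_funB; exact: measurable_quadratic_dev.
Qed.

Lemma corr_dev_second_moment p :
  (\int[P]_omega (corr_dev p omega ^+ 2)%:E <= (64 ^+ 2 / n%:R)%:E)%E.
Proof.
have msq b : measurable_fun setT (fun omega => (pair_dev b p omega ^+ 2)%:E).
  apply/measurable_EFinP; apply: measurable_funX; exact: measurable_quadratic_dev.
have m2 b := qdev_second_moment (qf_pair_vec_le4 b p.1 p.2 Sp).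
apply: (@le_trans _ _ (\int[P]_omega ((8^-1)%:E *
   ((pair_dev false p omega ^+ 2)%:E + (pair_dev true p omega ^+ 2)%:E)))%E).
  apply: ge0_le_integral => //.
  - by move=> omega _; rewrite lee_fin sqr_ge0.
  - by apply/measurable_EFinP; apply: measurable_funX; exact: measurable_corr_dev.
  - by apply: emeasurable_funM => //; exact: emeasurable_funD.
  - move=> omega _; rewrite -EFinD -EFinM lee_fin /corr_dev.
    by move: (pair_dev _ _ _) (pair_dev _ _ _) => a b; have := sqr_ge0 (a + b); nra.
rewrite ge0_integralZl_EFin//; last 2 first.
- by move=> omega _; rewrite -EFinD lee_fin addr_ge0 ?sqr_ge0.
- exact: emeasurable_funD.
rewrite ge0_integralD//; last 2 first.
- by move=> omega _; rewrite lee_fin sqr_ge0.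
- by move=> omega _; rewrite lee_fin sqr_ge0.
have -> : (64 ^+ 2 / n%:R : R)%:E = ((8^-1)%:E * ((128 ^+ 2 / n%:R)%:E + (128 ^+ 2 / n%:R)%:E))%E.
  by rewrite -EFinD -EFinM; congr EFin; lra.
by apply: lee_wpmul2l => //; apply: leeD; exact: m2.
Qed.

(** Each entry of the correlation error is governed by three deviations, its own and those of its
    two diagonal entries, as in [sample_corr_dev]. *)
Definition corr_dev_sum (S : {set 'I_d * 'I_d}) (omega : Omega) : R :=
  \sum_(p in S) (corr_dev p omega ^+ 2 + corr_dev (p.1, p.1) omega ^+ 2
                 + corr_dev (p.2, p.2) omega ^+ 2).

Lemma corr_dev_sum_prob (S : {set 'I_d * 'I_d}) (c : R) : 0 < c ->
  (P [set omega | c <= corr_dev_sum S omega]%R <=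
     (#|S|%:R * (3 * 64 ^+ 2 / n%:R) / c)%:E)%E.
Proof.
move=> c0; have m2 p : measurable_fun setT (fun omega => corr_dev p omega ^+ 2).
  by apply: measurable_funX; exact: measurable_corr_dev.
have m3 (p : 'I_d * 'I_d) : measurable_fun setT (fun omega => corr_dev p omega ^+ 2 +
   corr_dev (p.1, p.1) omega ^+ 2 + corr_dev (p.2, p.2) omega ^+ 2).
  by apply: measurable_funD => //; exact: measurable_funD.
have n3 (p : 'I_d * 'I_d) omega : 0 <= corr_dev p omega ^+ 2 +
   corr_dev (p.1, p.1) omega ^+ 2 + corr_dev (p.2, p.2) omega ^+ 2.
  by rewrite !addr_ge0 ?sqr_ge0.
apply: markov_bound => //.
- by rewrite /corr_dev_sum; under eq_fun do rewrite -big_filter; exact: measurable_sum.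
- by move=> omega; apply: sumr_ge0.
rewrite /corr_dev_sum.
under eq_integral do rewrite -sumEFin -big_filter.
rewrite ge0_integral_sum//; last 2 first.
- by move=> p; exact/measurable_EFinP.
- by move=> p omega _; rewrite lee_fin.
have -> : (#|S|%:R * (3 * 64 ^+ 2 / n%:R) : R)%:E = (\sum_(p in S) (3 * 64 ^+ 2 / n%:R)%:E)%E.
  by rewrite sumEFin sumr_const mulr_natl.
rewrite big_filter; apply: lee_sum => p _.
under eq_integral do rewrite !EFinD.
have mE q : measurable_fun setT (fun omega => (corr_dev q omega ^+ 2)%:E).
  exact/measurable_EFinP.
have sqE q omega : (0 <= (corr_dev q omega ^+ 2)%:E)%E by rewrite lee_fin sqr_ge0.
rewrite !ge0_integralD//; last 2 first.
- by move=> omega _; rewrite adde_ge0.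
- exact: emeasurable_funD.
have -> : (3 * 64 ^+ 2 / n%:R : R)%:E = ((64 ^+ 2 / n%:R)%:E + (64 ^+ 2 / n%:R)%:E + (64 ^+ 2 / n%:R)%:E)%E.
  by rewrite -!EFinD; congr EFin; lra.
by rewrite !leeD// corr_dev_second_moment.
Qed.

(** A single observation suffices: each of its coordinates is normal, so it vanishes with
    probability 0. This makes the sample correlation well defined where no concentration is
    available. *)
Lemma sample_diag_ae_gt0 :
  exists A : set Omega, [/\ measurable A,
    forall omega, A omega -> forall i, 0 < sample_cov (fun k => X k omega) i i &
    (1 <= P A)%E].
Proof.
pose k0 := Ordinal n0; pose N i := [set omega | tnth (X k0 omega) i = 0].
have mN i : measurable (N i).
  rewrite (_ : N i = (fun omega => tnth (X k0 omega) i) @^-1` [set 0])//.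
  rewrite -[X in measurable X]setTI.
  have /(_ measurableT [set 0]) : measurable_fun setT (fun omega => tnth (X k0 omega) i).
    by apply: (measurableT_comp (measurable_tnth i)); exact: measurable_funPT.
  by apply; exact: measurable_set1.
have PN i : (P (N i) <= 0%:E)%E.
  have e0 : (delta_mx i 0 : 'cV[R]_d) != 0.
    by apply/eqP => /matrixP/(_ i 0); rewrite !mxE !eqxx => /eqP; rewrite oner_eq0.
  have := gX.2 k0 (delta_mx i 0) e0 [set 0] (measurable_set1 0).
  set v := Num.sqrt _.
  have /null_content_dominatesP -> // := normal_prob_dominates 0 v; last exact: lebesgue_measure_set1.
  move=> PN0; have -> : N i = [set omega | [set (0 : R)]
      (\sum_j (delta_mx i 0 : 'cV[R]_d) j 0 * tnth (X k0 omega) j)].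
    apply/funext => omega; congr (_ = 0).
    rewrite (bigD1 i)//= mxE !eqxx mul1r big1 ?addr0// => j /negbTE ji.
    by rewrite mxE ji mul0r.
  by rewrite PN0.
have mU : measurable (\big[setU/set0]_i N i) by exact: bigsetU_measurable.
exists (~` (\big[setU/set0]_i N i)); split; first exact: measurableC.
  move=> omega nN i; rewrite sample_covE mulr_gt0 ?invr_gt0//.
  rewrite (bigD1 k0)//= ltr_wpDr//.
    by apply: sumr_ge0 => k _; rewrite -expr2 sqr_ge0.
  rewrite -expr2 exprn_even_gt0//=; apply/eqP => h.
  by apply: nN; rewrite (bigD1 i)//=; left.
rewrite probability_setC//.
have := measure_union_le mN PN; rewrite mulr0.
have Pf : P (\big[setU/set0]_i N i) \is a fin_num by exact: fin_num_measure.
by rewrite -[P _]fineK// -EFinB !lee_fin; lra.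
Qed.

Lemma sample_corr_norm_le1 omega : (forall i, 0 < sample_cov (fun k => X k omega) i i) ->
  (forall i, (sample_corr X omega - correlation Sigma) i i = 0) /\
  forall i j, `|(sample_corr X omega - correlation Sigma) i j| <= 2.
Proof.
move=> h0; have S0 k := posdef_diag_gt0 k Sp; split=> [i|i j].
  by rewrite mxB_entry /sample_corr !correlation_diag// subrr.
rewrite mxB_entry; apply: le_trans (ler_normB _ _) _.
have := correlation_le1 i j Sp; suff : `|sample_corr X omega i j| <= 1 by lra.
rewrite correlationE// normrM normfV [`|Num.sqrt _ * _|]gtr0_norm ?mulr_gt0 ?sqrtr_gt0//.
rewrite ler_pdivrMr ?mulr_gt0 ?sqrtr_gt0// mul1r !sample_covE.
rewrite !sqrtrM ?invr_ge0 ?(ltW nR)// mulrACA -expr2 sqr_sqrtr ?invr_ge0 ?(ltW nR)//.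
rewrite normrM ger0_norm ?invr_ge0 ?(ltW nR)// ler_wpM2l ?invr_ge0 ?(ltW nR)//.
under [X in _ <= Num.sqrt X * _]eq_bigr do rewrite -expr2.
under [X in _ <= _ * Num.sqrt X]eq_bigr do rewrite -expr2.
exact: norm_sum_cauchy_schwarz.
Qed.

End Concentration.

(** * Consequences of the assumptions *)

Section Assembly.
Context {R : realType}.

(** Schur test: each product of two coordinates is at most half the sum of their squares, and
    symmetry merges the two resulting sums. *)
Lemma qf_le_row_sum n (A : 'M[R]_n) k (x : 'cV[R]_n) : A^T = A ->
  (forall i, \sum_j `|A i j| <= k) -> qf A x <= k * frobenius_norm x ^+ 2.
Proof.
move=> At Ak; have Asym i j : A j i = A i j by rewrite -[in LHS]At mxE.
have -> : frobenius_norm x ^+ 2 = \sum_i x i 0 ^+ 2.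
  rewrite frobenius_sqr /inner_mx /mxtrace big_ord1 mxE.
  by apply: eq_bigr => i _; rewrite mxE expr2.
have -> : qf A x = \sum_i \sum_j x i 0 * A i j * x j 0.
  rewrite /qf mxE exchange_big /=; apply: eq_bigr => j _; rewrite mxE mulr_suml.
  by apply: eq_bigr => i _; rewrite mxE.
apply: (@le_trans _ _ (\sum_i \sum_j (`|A i j| * x i 0 ^+ 2 / 2 + `|A i j| * x j 0 ^+ 2 / 2))).
  apply: ler_sum => i _; apply: ler_sum => j _.
  apply: le_trans (ler_norm _) _; rewrite !normrM.
  rewrite -[x i 0 ^+ 2]real_normK ?num_real// -[x j 0 ^+ 2]real_normK ?num_real//.
  have := normr_ge0 (A i j); have := sqr_ge0 (`|x i 0| - `|x j 0|).
  move: `|A i j| `|x i 0| `|x j 0| => a u v h1 h2.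
  by have := mulr_ge0 h2 h1; lra.
have -> : \sum_i \sum_j (`|A i j| * x i 0 ^+ 2 / 2 + `|A i j| * x j 0 ^+ 2 / 2) =
    \sum_i (\sum_j `|A i j|) * x i 0 ^+ 2.
  under eq_bigr do rewrite big_split /=.
  rewrite big_split /= [X in _ + X]exchange_big /= -big_split; apply: eq_bigr => i _ /=.
  under [X in _ + X]eq_bigr do rewrite Asym.
  by rewrite -!mulr_suml; lra.
by rewrite mulr_sumr; apply: ler_sum => i _; rewrite ler_wpM2r ?sqr_ge0.
Qed.

Lemma row_sum_le_infinity_norm m n (A : 'M[R]_(m, n)) i :
  \sum_j `|A i j| <= infinity_norm A.
Proof. exact: (le_bigmax _ (fun i => \sum_j `|A i j|) i). Qed.

Lemma sigma_min_le n (A : 'M[R]_n) j : (forall i, 0 < A i i) ->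
  sigma_min A <= Num.sqrt (A j j).
Proof.
move=> A0; rewrite ler_wsqrtr//; apply: ge_inf; last by exists j.
by exists 0 => _ [i _ <-]; exact: ltW.
Qed.

(** Entrywise form of Psi* = W Theta* W, which carries zeros of Theta* over to Psi*. *)
Lemma inv_correlationE n (A : 'M[R]_n) i j : posdef A ->
  inv_correlation A i j = Num.sqrt (A i i) * precision A i j * Num.sqrt (A j j).
Proof.
move=> Ap; have A0 k := posdef_diag_gt0 k Ap.
set D := std_diag A; have Du : D \in unitmx.
  rewrite unitmxE unitfE det_diag; apply/prodf_neq0 => k _.
  by rewrite mxE sqrtr_eq0 -ltNge.
have Cu := posdef_unit (posdef_correlation Ap).
have -> : inv_correlation A = D *m invmx A *m D.
  apply: (can_inj (mulKmx Cu)); rewrite mulmxV// /correlation -/D !mulmxA (mulmxKV Du) (mulmxK (posdef_unit Ap)).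
  by rewrite mulVmx.
by rewrite /D /std_diag mul_mx_diag mxE mul_diag_mx !mxE.
Qed.

(** * The estimators on a realization with small gradient *)

Section Deterministic.
Variables (M eps1 alpha : R) (s d : nat) (Sigma : 'M[R]_d) (lambda : R) (w : R -> R).
Variable Chat : 'M[R]_d.
Let Psi := inv_correlation Sigma.
Let S := off_support (precision Sigma).
Let p := spectral_norm Psi.
Let r0 := eps1 ^+ 2 / (2 * Num.max M 1).
Hypotheses (eps1_gt0 : 0 < eps1) (d0 : (0 < d)%N) (Sp : posdef Sigma).
Hypotheses (Ss : (#|S| <= s)%N) (SM : infinity_norm Sigma <= M).
Hypotheses (Smin : eps1 <= sigma_min Sigma) (lam0 : 0 < lambda).
Hypotheses (A2 : assumption2 alpha lambda w Sigma) (A3 : assumption3 alpha lambda Sigma).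
Hypothesis lamr0 : `|alpha| / 4 * (lambda * Num.sqrt s%:R) < r0.
Hypotheses (G0 : forall i, (Chat - correlation Sigma) i i = 0)
  (Gle : forall i j, `|(Chat - correlation Sigma) i j| <= lambda / 4).

Let S0 k : 0 < Sigma k k. Proof. exact: posdef_diag_gt0. Qed.
Let M1 : 0 < Num.max M 1. Proof. by rewrite lt_max ltr01 orbT. Qed.
Let Cp : posdef (correlation Sigma). Proof. exact: posdef_correlation. Qed.
Let Pp : posdef Psi. Proof. exact: posdef_inv. Qed.
Let m := Num.max M 1 / eps1 ^+ 2.
Let m0 : 0 < m. Proof. by rewrite divr_gt0// exprn_gt0. Qed.
Let r0E : r0 = m^-1 / 2.
Proof. by rewrite /r0 /m invf_div [2 * _]mulrC invfM mulrA. Qed.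
Let r00 : 0 < r0. Proof. by rewrite r0E divr_gt0// invr_gt0. Qed.

(** The absolute row sums of the correlation matrix are at most [m], and [qf_inv_ge] inverts this
    into a bound free of the dimension. *)
Lemma inv_correlation_qf_ge x : m^-1 * frobenius_norm x ^+ 2 <= qf Psi x.
Proof.
rewrite ler_pdivrMl//; apply: qf_inv_ge => // y.
apply: qf_le_row_sum; first exact: Cp.1.
move=> i; apply: (@le_trans _ _ (infinity_norm Sigma / eps1 ^+ 2)); last first.
  by rewrite ler_wpM2r ?invr_ge0 ?sqr_ge0// le_max SM.
apply: (@le_trans _ _ ((\sum_j `|Sigma i j|) / eps1 ^+ 2)); last first.
  by rewrite ler_wpM2r ?invr_ge0 ?sqr_ge0// row_sum_le_infinity_norm.
have sge k : eps1 <= Num.sqrt (Sigma k k) by apply: le_trans Smin _; exact: sigma_min_le.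
rewrite mulr_suml; apply: ler_sum => j _; rewrite correlationE// normrM normfV.
rewrite ler_wpM2l// lef_pV2 ?posrE ?exprn_gt0 ?normr_gt0 ?mulf_neq0 ?sqrtr_eq0 -?ltNge//.
by rewrite ger0_norm ?mulr_ge0 ?sqrtr_ge0// expr2 ler_pM// ltW.
Qed.

Let Pb x : qf Psi x <= p * frobenius_norm x ^+ 2.
Proof. exact/qf_le_norm/spectral_norm_le. Qed.

Let mp : m^-1 <= p.
Proof.
pose x : 'cV[R]_d := delta_mx (Ordinal d0) 0.
have x1 : 0 < frobenius_norm x ^+ 2.
  rewrite exprn_gt0// lt0r frobenius_norm_ge0 andbT; apply/eqP => /frobenius_norm_eq0.
  by move=> /matrixP/(_ (Ordinal d0) 0); rewrite !mxE !eqxx => /eqP; rewrite oner_eq0.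
by rewrite -(ler_pM2r x1); apply: le_trans (inv_correlation_qf_ge x) (Pb x).
Qed.

Let p0 : 0 < p. Proof. by apply: lt_le_trans mp; rewrite invr_gt0. Qed.

Let cp : 64 * p ^+ 2 <= c_const Sigma.
Proof.
rewrite /c_const -/Psi -/p; have : 0 <= Num.max (infinity_norm Sigma ^+ 2) 1.
  by rewrite le_max ler01 orbT.
by move: (Num.max _ _) => y; lra.
Qed.

(** As [w] is at least 1/2 at [c * lambda] and 0 at [alpha * lambda], monotonicity gives
    [c <= alpha], while [64 * p ^+ 2 <= c]. This makes the later constants depend on [alpha] instead
    of the spectral norm. *)
Lemma spectral_norm_sqr_le : 16 * p ^+ 2 <= `|alpha| / 4.
Proof.
have [whomo _ _ wa wc] := A2.
have : c_const Sigma <= alpha.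
  rewrite leNgt; apply/negP => /ltW h.
  have : w (c_const Sigma * lambda) <= w (alpha * lambda).
    by apply: whomo; rewrite ler_wpM2r// ltW.
  by rewrite wa; move: wc; lra.
by have := ler_norm alpha; have := cp; lra.
Qed.

Lemma adaptive_est_good l : (0 < l)%N ->
  [/\ est_is_argmin w lambda Chat l,
      frobenius_norm (adaptive_est w lambda Chat l - Psi) <=
        8 * p ^+ 2 * frobenius_norm (restrict_mx S (gradient (loss Chat) Psi))
        + 2^-1 * frobenius_norm (adaptive_est w lambda Chat l.-1 - Psi)
    & frobenius_norm (adaptive_est w lambda Chat l - Psi) <=
        16 * p ^+ 2 * (lambda * Num.sqrt s%:R)].
Proof.
have [whomo w01 w1 wa wc] := A2.
have PsiV : invmx Psi = correlation Sigma by rewrite invmxK.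
rewrite gradient_loss//.
(* [r0] is half of the lower bound [m^-1], so a perturbation of this size leaves the form
   positive. *)
have ball (B : 'M[R]_d) : B^T = B -> frobenius_norm (B - Psi) <= r0 -> posdef B.
  move=> Bt Br; split=> // x x0; rewrite -[X in 0 < X]/(qf B x).
  have nx : 0 < frobenius_norm x ^+ 2.
    rewrite exprn_gt0// lt0r frobenius_norm_ge0 andbT.
    by apply: contra_neq x0; exact: frobenius_norm_eq0.
  have -> : qf B x = qf Psi x + qf (B - Psi) x by rewrite -qfD addrC subrK.
  have h1 := inv_correlation_qf_ge x; have h2 := qf_ge_frobenius (B - Psi) x.
  have h3 : frobenius_norm (B - Psi) * frobenius_norm x ^+ 2 <= r0 * frobenius_norm x ^+ 2.
    by rewrite ler_wpM2r// ltW.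
  have h4 : 0 < r0 * frobenius_norm x ^+ 2 by rewrite mulr_gt0.
  by have mE : m^-1 = 2 * r0 by [rewrite r0E; lra]; rewrite mE in h1; lra.
have r0p : r0 <= p by have := mp; have := r0E; have := r00; lra.
have lamp : 16 * p ^+ 2 * (lambda * Num.sqrt s%:R) < r0.
  apply: le_lt_trans lamr0; rewrite ler_wpM2r ?spectral_norm_sqr_le//.
  by rewrite mulr_ge0 ?sqrtr_ge0// ltW.
have Sd i : (i, i) \notin S by rewrite inE /= eqxx.
have PS i j : i != j -> (i, j) \notin S -> Psi i j = 0.
  rewrite inE /= => -> /=; rewrite negbK => /eqP h.
  by rewrite /Psi inv_correlationE// h mulr0 mul0r.
have G0' i : (Chat - invmx Psi) i i = 0 by rewrite PsiV.
have Gle' i j : `|(Chat - invmx Psi) i j| <= lambda / 4 by rewrite PsiV.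
exact: (adaptive_est_spec Pp p0 Pb ball r0p lamp Sd Ss PS A3 whomo w01 w1 wa wc
  lam0 cp G0' Gle' l).2.
Qed.

End Deterministic.

(** * The event of high probability *)

Section GoodEvent.
Context {disp : measure_display} {Omega : measurableType disp}.
Variables (P : probability Omega R) (n d : nat) (Sigma : 'M[R]_d).
Variables (X : 'I_n -> {RV P >-> d.-tuple R}) (lambda : R).
Hypotheses (n0 : (0 < n)%N) (d0 : (0 < d)%N) (Sp : posdef Sigma) (gX : iid_gaussian Sigma X).
Hypothesis lamge : 240 * rate n d <= lambda.

Lemma good_event : exists E : set Omega, [/\ measurable E,
  ((1 - 8 / d%:R)%:E <= P E)%E &
  forall omega, E omega ->
    [/\ forall i, (sample_corr X omega - correlation Sigma) i i = 0,
        forall i j, `|(sample_corr X omega - correlation Sigma) i j| <= lambda / 4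
      & 384 * ln (d%:R : R) <= n%:R -> forall p, `|corr_dev Sigma X p omega| <= 2^-1]].
Proof.
have nR : 0 < n%:R :> R by rewrite ltr0n.
have dR : 0 < d%:R :> R by rewrite ltr0n.
have lnd : 0 <= ln d%:R :> R by rewrite ln_ge0// ler1n.
have rate0 : 0 <= rate n d :> R by exact: sqrtr_ge0.
have rate2 : rate n d ^+ 2 = ln d%:R / n%:R :> R by rewrite sqr_sqrtr// divr_ge0// ltW.
have lam0 : 0 <= lambda by apply: le_trans lamge; rewrite mulr_ge0.
have lam2 : (240 * rate n d) ^+ 2 <= lambda ^+ 2.
  by apply: lerXn2r; rewrite ?nnegrE; [exact: mulr_ge0|exact: lam0|exact: lamge].
rewrite exprMn rate2 in lam2.
have [nd|nd] := leP (384 * ln d%:R) (n%:R : R); last first.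
  have [E [mE Epos PE]] := sample_diag_ae_gt0 n0 gX.
  exists E; split=> //.
    by apply: le_trans PE; rewrite lee_fin gerBl divr_ge0// ltW.
  move=> omega /Epos /(sample_corr_norm_le1 n0 Sp)[G0 G2]; split=> // i j.
  (* In this regime [lambda ^+ 2] exceeds 240^2 / 384 = 150, so [lambda] exceeds 8. *)
  apply: le_trans (G2 i j) _; rewrite ler_pdivlMr//.
  rewrite -(@ler_pXn2r _ 2)// ?nnegrE//; apply: le_trans lam2.
  rewrite mulrA ler_pdivlMr//; lra.
have q0 : 0 <= ln d%:R / n%:R :> R by exact: divr_ge0 lnd (ltW nR).
pose t := Num.sqrt (384 * (ln d%:R / n%:R)) : R.
have t0 : 0 <= t by exact: sqrtr_ge0.
have t2 : t ^+ 2 = 384 * (ln d%:R / n%:R).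
  by rewrite sqr_sqrtr; last by apply: mulr_ge0; [exact: ler0n|exact: q0].
have t1 : t <= 1.
  by rewrite -(@ler_pXn2r _ 2)// ?nnegrE// t2 expr1n mulrA ler_pdivrMr// mul1r.
(* Deviations of at most [t / 2] give gradient entries of at most [3 * t], to be compared with
   [lambda / 4]. Here 12^2 * 384 = 55296 is below 240^2 = 57600. *)
have tlam : 12 * t <= lambda.
  rewrite -(@ler_pXn2r _ 2)// ?nnegrE ?mulr_ge0//; apply: le_trans lam2.
  by rewrite exprMn t2 [12 ^+ 2 * _]mulrA; apply: ler_wpM2r; [exact: q0|lra].
have [|E [mE Edev PE]] := @all_pair_dev_prob R _ _ P n d Sigma X n0 Sp gX t.
  by rewrite t0/=; lra.
have Edev2 omega : E omega -> forall p, `|corr_dev Sigma X p omega| <= t / 2.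
  move=> /Edev h p; have := h false p; have := h true p; rewrite /corr_dev.
  move: (pair_dev _ _ _ _ _) (pair_dev _ _ _ _ _) => a b ha hb.
  rewrite normrM [`|4^-1|]ger0_norm//.
  by have := ler_normB a b; lra.
exists E; split=> //.
  apply: le_trans PE; rewrite lee_fin lerD2l lerN2.
  (* 384 = 3 * 128 was chosen for this: the exponential becomes [d ^- 3], and the [4 * d ^+ 2] of
     the union bound leaves 4/d. *)
  have -> : n%:R * t ^+ 2 / 128 = ln d%:R * 3%:R.
    by rewrite t2; field; exact: lt0r_neq0.
  rewrite expRN expRM_natr lnK ?posrE//.
  have -> : 4 * d%:R ^+ 2 * (d%:R ^+ 3)^-1 = 4 / d%:R :> R by field; exact: lt0r_neq0.
  by rewrite ler_wpM2r ?invr_ge0 ?(ltW dR)// ler_nat.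
move=> omega /Edev2 h.
have h2 p : `|corr_dev Sigma X p omega| <= 2^-1 by apply: le_trans (h p) _; lra.
have [G0 Gd] := sample_corr_dev n0 Sp h2; split=> // i j.
apply: le_trans (Gd i j) _.
by have := h (i, j); have := h (i, i); have := h (j, j); lra.
Qed.

End GoodEvent.

End Assembly.

(** * Sample size constant, geometric iteration and the theorem *)

Section Final.
Context {R : realType}.

Definition radius (M eps1 : R) : R := eps1 ^+ 2 / (2 * Num.max M 1).

(** The 384 forces [384 * ln d <= n] as soon as [s] is positive; the square keeps the first
    localization radius inside the ball where matrices remain positive definite. *)
Definition sample_const (M eps1 alpha B : R) : R :=
  384 + (`|alpha| * B / radius M eps1) ^+ 2.

Lemma sample_const_ge (M eps1 alpha B : R) : 384 <= sample_const M eps1 alpha B.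
Proof. by rewrite lerDl sqr_ge0. Qed.

Lemma sample_const_gt0 (M eps1 alpha B : R) : 0 < sample_const M eps1 alpha B.
Proof. by apply: lt_le_trans (sample_const_ge _ _ _ _); rewrite ltr0n. Qed.

Lemma radius_gt0 (M eps1 : R) : 0 < eps1 -> 0 < radius M eps1.
Proof.
by move=> e0; rewrite divr_gt0 ?exprn_gt0// mulr_gt0// lt_max ltr01 orbT.
Qed.

Lemma penalty_small (M eps1 alpha B lambda : R) (n d s : nat) :
  0 < eps1 -> 0 < B -> (0 < n)%N -> (0 < d)%N ->
  sample_const M eps1 alpha B * (s%:R * ln d%:R) <= n%:R ->
  0 < lambda -> lambda <= B * rate n d ->
  `|alpha| / 4 * (lambda * Num.sqrt s%:R) < radius M eps1.
Proof.
move=> e0 B0 n0 d0 nC lam0 lamB.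
have r0 := radius_gt0 M e0; set r := radius M eps1 in r0 *.
have nR : 0 < n%:R :> R by rewrite ltr0n.
have lnd : 0 <= ln d%:R :> R by rewrite ln_ge0// ler1n.
have rate2 : rate n d ^+ 2 = ln d%:R / n%:R :> R by rewrite sqr_sqrtr// divr_ge0// ltW.
set K := sample_const _ _ _ _ in nC.
have K0 : 0 < K by exact: sample_const_gt0.
have sl : s%:R * (ln d%:R / n%:R) <= K^-1 :> R.
  by rewrite mulrA ler_pdivrMr// ler_pdivlMl.
have sq0 : 0 <= Num.sqrt (s%:R : R) by exact: sqrtr_ge0.
have x0 : 0 <= `|alpha| / 4 * (lambda * Num.sqrt s%:R).
  by apply: mulr_ge0; [exact: divr_ge0|exact: mulr_ge0 (ltW lam0) sq0].
rewrite -(@ltr_pXn2r _ 2) ?nnegrE ?(ltW r0)//.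
have lam2 : lambda ^+ 2 <= B ^+ 2 * (ln d%:R / n%:R).
  rewrite -rate2 -exprMn; apply: lerXn2r; rewrite ?nnegrE//; first exact: ltW.
  by apply: mulr_ge0; [exact: ltW|exact: sqrtr_ge0].
have -> : (`|alpha| / 4 * (lambda * Num.sqrt s%:R)) ^+ 2 =
    `|alpha| ^+ 2 * 4^-1 ^+ 2 * (lambda ^+ 2 * s%:R).
  by rewrite !exprMn sqr_sqrtr ?ler0n.
have h1 : lambda ^+ 2 * s%:R <= B ^+ 2 * K^-1.
  apply: (@le_trans _ _ (B ^+ 2 * (ln d%:R / n%:R) * s%:R)).
    by apply: ler_wpM2r; [exact: ler0n|].
  by rewrite -mulrA [_ * s%:R]mulrC; apply: ler_wpM2l; [exact: sqr_ge0|].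
have h2 : `|alpha| ^+ 2 * B ^+ 2 < r ^+ 2 * K.
  have -> : `|alpha| ^+ 2 * B ^+ 2 = r ^+ 2 * (`|alpha| * B / r) ^+ 2.
    by field; exact: lt0r_neq0.
  by rewrite ltr_pM2l ?exprn_gt0// /K /sample_const ltrDr ltr0n.
have h3 : `|alpha| ^+ 2 * (lambda ^+ 2 * s%:R) < r ^+ 2.
  apply: (@le_lt_trans _ _ (`|alpha| ^+ 2 * (B ^+ 2 * K^-1))).
    by apply: ler_wpM2l; [exact: sqr_ge0|].
  by rewrite mulrA ltr_pdivrMr.
apply: le_lt_trans h3; rewrite exprVn mulrAC ler_pdivrMr ?exprn_gt0//.
rewrite ler_peMr//; last by rewrite -natrX ler1n.
by apply: mulr_ge0; [exact: sqr_ge0|apply: mulr_ge0; [exact: sqr_ge0|exact: ler0n]].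
Qed.

Lemma expR_half_le2 : expR 2^-1 <= 2 :> R.
Proof.
have := expR_ge1Dx (- 2^-1 : R); rewrite expRN.
have e0 := expR_gt0 (2^-1 : R).
by move=> /(ler_wpM2r (ltW e0)); rewrite mulVf ?gt_eqF//; lra.
Qed.

(** The factor 2 comes from [expR 2^-1 <= 2] and becomes the constant in the lower bound on the
    number of iterations. *)
Lemma pow2_ge_of_ln (x : R) (T : nat) : 0 < x -> 2 * ln x <= T%:R -> x <= 2 ^+ T.
Proof.
move=> x0 h; rewrite -[leLHS]lnK ?posrE//.
apply: (@le_trans _ _ (expR (2^-1 * T%:R))); first by rewrite ler_expR; lra.
rewrite expRM_natr; apply: lerXn2r; rewrite ?nnegrE ?expR_ge0//.
exact: expR_half_le2.
Qed.

(** The recursion is unrolled only down to index 1, where an absolute bound is known; [a 0] is the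
    norm of Psi* and has no uniform bound. *)
Lemma geometric_contraction (a : nat -> R) (b c : R) T : (0 < T)%N -> 0 <= b ->
  (forall l, (0 < l)%N -> a l <= b + 2^-1 * a l.-1) -> a 1%N <= c ->
  a T <= 2 * b + 2 * c / 2 ^+ T.
Proof.
case: T => // T _ b0 ab a1; elim: T => [|T IH].
  by rewrite expr1; lra.
apply: le_trans (ab T.+2 isT) _; rewrite /= exprS invfM.
by move: IH; move: (_ ^+ T.+1)^-1 => u; lra.
Qed.

(** The 12 is the square of the 2 in [sample_corr_dev] times 3, from the square of a sum of three
    terms. *)
Lemma restrict_sample_corr_le n d (Sigma : 'M[R]_d) (disp : measure_display)
    (Omega : measurableType disp) (P : probability Omega R)
    (X : 'I_n -> {RV P >-> d.-tuple R}) (S : {set 'I_d * 'I_d}) omega :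
  (0 < n)%N -> posdef Sigma -> (forall p, `|corr_dev Sigma X p omega| <= 2^-1) ->
  frobenius_norm (restrict_mx S (sample_corr X omega - correlation Sigma)) <=
  Num.sqrt (12 * corr_dev_sum Sigma X S omega).
Proof.
move=> n0 Sp h; rewrite frobenius_normE; apply: ler_wsqrtr.
rewrite /corr_dev_sum mulr_sumr [leRHS]big_mkcond /=.
apply: ler_sum => -[i j] _; rewrite mxE /=; case: ifPn => [_|_]; last by rewrite expr0n.
have := (sample_corr_dev n0 Sp h).2 i j.
have sqn (x : R) : x ^+ 2 = `|x| ^+ 2 by rewrite real_normK ?num_real.
rewrite sqn [corr_dev _ _ (i, j) _ ^+ 2]sqn [corr_dev _ _ (i, i) _ ^+ 2]sqn
  [corr_dev _ _ (j, j) _ ^+ 2]sqn.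
have := normr_ge0 (corr_dev Sigma X (i, j) omega).
have := normr_ge0 (corr_dev Sigma X (i, i) omega).
have := normr_ge0 (corr_dev Sigma X (j, j) omega).
have := normr_ge0 ((sample_corr X omega - correlation Sigma) i j).
move: `|_| `|_| `|_| `|_| => g x y z g0 x0 y0 z0 gle.
apply: (@le_trans _ _ ((2 * (g + x + y)) ^+ 2)).
  by apply: lerXn2r => //; rewrite nnegrE mulr_ge0// !addr_ge0.
have := sqr_ge0 (x - y); have := sqr_ge0 (y - g); have := sqr_ge0 (x - g); nra.
Qed.

Lemma probability_setI_ge (disp : measure_display) (Omega : measurableType disp)
    (P : probability Omega R) (E F : set Omega) (a b : R) :
  measurable E -> measurable F -> ((1 - a)%:E <= P E)%E -> ((1 - b)%:E <= P F)%E ->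
  ((1 - (a + b))%:E <= P (E `&` F))%E.
Proof.
move=> mE mF PE PF.
have mEF : measurable (~` E `|` ~` F) by apply: measurableU; exact: measurableC.
have h : (P (~` E `|` ~` F) <= P (~` E) + P (~` F))%E.
  by apply: measureU2; exact: measurableC.
have -> : E `&` F = ~` (~` E `|` ~` F) by rewrite setCU !setCK.
rewrite probability_setC//; move: h; rewrite !probability_setC//.
have fE A : measurable A -> P A \is a fin_num by exact: fin_num_measure.
move: PE PF; rewrite -[P E]fineK ?fE// -[P F]fineK ?fE// -[P (_ `|` _)]fineK ?fE//.
by rewrite -!EFinB -EFinD !lee_fin; lra.
Qed.

End Final.

Theorem theorem3p5 (R : realType) (M eps1 eps2 alpha : R)
    (eps1_gt0 : 0 < eps1) (eps2_gt0 : 0 < eps2) :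
  exists2 A : R, 0 < A & forall B : R, A <= B ->
  exists2 C : R, 0 < C &
  (forall (n d s T : nat) (Sigma : 'M[R]_d) (lambda : R) (w : R -> R)
      (disp : measure_display) (Omega : measurableType disp)
      (P : probability Omega R) (X : 'I_n -> {RV P >-> d.-tuple R}),
    setting M eps1 eps2 alpha A B C s Sigma lambda w X ->
    let Psi := inv_correlation Sigma in
    let S := off_support (precision Sigma) in
    with_prob_ge P (1 - 8 / d%:R) [set omega |
      let Chat := sample_corr X omega in
      let Psihat := adaptive_est w lambda Chat in
      forall l, (1 <= l <= T)%N ->
        est_is_argmin w lambda Chat l /\
        frobenius_norm (Psihat l - Psi) <=
          8 * spectral_norm Psi ^+ 2
            * frobenius_norm (restrict_mx S (gradient (loss Chat) Psi))
          + 2^-1 * frobenius_norm (Psihat l.-1 - Psi)])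
  /\
  (exists2 CT : R, 0 < CT & forall k : R, 0 < k ->
    forall (d s T : nat -> nat) (Sigma : forall n, 'M[R]_(d n))
      (lambda : nat -> R) (w : nat -> R -> R)
      (disp : nat -> measure_display)
      (Omega : forall n, measurableType (disp n))
      (P : forall n, probability (Omega n) R)
      (X : forall n, 'I_n -> {RV (P n) >-> (d n).-tuple R}),
    (d n @[n --> \oo] --> \oo) ->
    (\forall n \near \oo,
      [/\ setting M eps1 eps2 alpha A B C (s n) (Sigma n) (lambda n) (w n)
            (X n),
          CT * ln (lambda n * Num.sqrt n%:R) <= (T n)%:R
        & k * ln (ln (d n)%:R) <= ln (lambda n * Num.sqrt n%:R)]) ->
    bounded_in_prob P
      (fun n omega =>
        frobenius_norm (adaptive_est (w n) (lambda n) (sample_corr (X n) omega)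
                          (T n)
                        - inv_correlation (Sigma n)))
      (fun n => Num.sqrt ((s n)%:R / n%:R))).
Proof.
exists 240; first by rewrite ltr0n.
move=> B AB; have B0 : 0 < B by apply: lt_le_trans AB; rewrite ltr0n.
exists (sample_const M eps1 alpha B); first exact: sample_const_gt0.
split.
  move=> n d s T Sigma lambda w disp Omega P X.
  move=> [[n0 d0 Sp gX] [[Ss SM [/andP[Smin _] _] _] A2 A3] nC lam0 /andP[lamA lamB]] Psi S.
  have [E [mE PE Egood]] := good_event n0 d0 Sp gX lamA.
  exists E; split=> // omega /Egood[G0 Gle _] /= l /andP[l0 _].
  have lamr := penalty_small eps1_gt0 B0 n0 d0 nC lam0 lamB.
  by have [] := adaptive_est_good eps1_gt0 d0 Sp Ss SM Smin lam0 A2 A3 lamr G0 Gle l0.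
exists 2 => // k k0 d s T Sigma lambda w disp Omega P X dinf Hnear eps eps0.
(* Markov's inequality at level [c * (s / n)] then fails with probability at most [eps / 2]. *)
pose c := 3 * 64 ^+ 2 * 2 / eps.
have c0 : 0 < c by apply: divr_gt0 => //; apply: mulr_gt0 => //; apply: mulr_gt0.
(* The first summand covers the gradient on the support, the 2 the geometric remainder; the final 1
   only ensures positivity. *)
exists (`|alpha| / 4 * (Num.sqrt (12 * c) + 2) + 1).
  by rewrite ltr_wpDl// mulr_ge0 ?divr_ge0// addr_ge0 ?sqrtr_ge0.
near=> n.
have [[[n0 d0 Sp gX] [[Ss SM [/andP[Smin _] _] _] A2 A3] nC lam0 /andP[lamA lamB]] hT hk] :
    [/\ setting M eps1 eps2 alpha 240 B (sample_const M eps1 alpha B) (s n) (Sigma n)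
          (lambda n) (w n) (X n),
        2 * ln (lambda n * Num.sqrt n%:R) <= (T n)%:R
      & k * ln (ln (d n)%:R) <= ln (lambda n * Num.sqrt n%:R)] by near: n.
(* The 16 makes [ln (ln d)] positive, hence [T] positive; the other bound gives
   [8 / d <= eps / 2]. *)
have dbig : (maxn 16 (Num.bound (16 / eps)) <= d n)%N.
  near: n; exact: (dinf _ (nbhs_infty_ge _)).
have d16 : (16 <= d n)%N by apply: leq_trans dbig; exact: leq_maxl.
have deps : 8 / (d n)%:R <= eps / 2.
  have h : 16 / eps < (d n)%:R.
    apply: lt_le_trans (archi_boundP _) _; first by rewrite divr_ge0// ltW.
    by rewrite ler_nat; apply: leq_trans dbig; exact: leq_maxr.
  have dR : 0 < (d n)%:R :> R by rewrite ltr0n.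
  rewrite ler_pdivrMr//; move: h; rewrite ltr_pdivrMr//; lra.
have nR : 0 < n%:R :> R by rewrite ltr0n.
have lnln : 0 < ln (ln (d n)%:R) :> R.
  rewrite ln_gt0// -ltr_expR lnK ?posrE ?ltr0n//.
  apply: (@le_lt_trans _ _ (2 ^+ 2)).
    have := expRM_natr 2 (2^-1 : R); rewrite mulVf// => ->.
    by apply: lerXn2r; rewrite ?nnegrE ?expR_ge0 ?expR_half_le2.
  by rewrite -natrX ltr_nat; apply: leq_trans d16.
have T0 : (0 < T n)%N.
  have : 0 < (T n)%:R :> R.
    apply: lt_le_trans hT; apply: mulr_gt0 => //; apply: lt_le_trans hk; exact: mulr_gt0.
  by rewrite ltr0n.
set p2 := 16 * spectral_norm (inv_correlation (Sigma n)) ^+ 2.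
have p2le : p2 <= `|alpha| / 4.
  exact: (spectral_norm_sqr_le lam0 A2).
have p20 : 0 <= p2 by apply: mulr_ge0 => //; exact: sqr_ge0.
have lamr := penalty_small eps1_gt0 B0 n0 d0 nC lam0 lamB.
have Psip := posdef_inv (posdef_correlation Sp).
have [E [mE PE Egood]] := good_event n0 d0 Sp gX lamA.
set S := off_support (precision (Sigma n)) in Ss.
have sn0 : 0 <= (s n)%:R / n%:R :> R by apply: divr_ge0.
have [E2 [mE2 PE2 E2good]] : exists E2 : set (Omega n), [/\ measurable E2,
    ((1 - eps / 2)%:E <= P n E2)%E &
    forall omega, E omega -> E2 omega ->
      frobenius_norm (restrict_mx S (sample_corr (X n) omega - correlation (Sigma n)))
      <= Num.sqrt (12 * c) * Num.sqrt ((s n)%:R / n%:R)].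
  (* For [s = 0] the Markov level would be 0, but then the support is empty and the restricted
     gradient vanishes. *)
  have [s0|s0] := posnP (s n).
    exists setT; split=> //.
      by rewrite probability_setT lee_fin gerBl divr_ge0// ltW.
    move=> omega _ _; have -> : S = finset.set0.
      by apply/eqP; rewrite -cards_eq0 -leqn0 -s0.
    rewrite frobenius_normE big1 ?sqrtr0 ?mulr_ge0 ?sqrtr_ge0// => q _.
    by rewrite mxE inE expr0n.
  pose g := corr_dev_sum (Sigma n) (X n) S.
  have sn1 : 0 < (s n)%:R / n%:R :> R by rewrite divr_gt0// ltr0n.
  have := corr_dev_sum_prob n0 Sp gX S (mulr_gt0 c0 sn1).
  set F := [set omega | _ <= _] => PF.
  have mF : measurable F.
    apply: measurable_ge_fun; rewrite /corr_dev_sum.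
    under eq_fun do rewrite -big_filter; apply: measurable_sum => q.
    by repeat apply: measurable_funD; apply: measurable_funX; exact: measurable_corr_dev.
  exists (~` F); split; first exact: measurableC.
    rewrite probability_setC//.
    have Pf : P n F \is a fin_num by exact: fin_num_measure.
    move: PF; rewrite -[P n F]fineK// -EFinB !lee_fin => PF.
    rewrite lerD2l lerN2; apply: le_trans PF _.
    apply: (@le_trans _ _ ((s n)%:R * (3 * 64 ^+ 2 / n%:R) / (c * ((s n)%:R / n%:R)))).
      apply: ler_wpM2r; first by rewrite invr_ge0; apply: mulr_ge0 => //; exact: ltW.
      apply: ler_wpM2r; last by rewrite ler_nat.
      by apply: divr_ge0 => //; apply: mulr_ge0 => //; exact: sqr_ge0.
    rewrite le_eqVlt; apply/orP; left; apply/eqP; rewrite /c; field.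
    by rewrite !lt0r_neq0// ltr0n.
  move=> omega /Egood[_ _ hdev] nF.
  have n384 : 384 * ln (d n)%:R <= n%:R :> R.
    apply: le_trans nC; have lnd : 0 <= ln (d n)%:R :> R by rewrite ln_ge0// ler1n.
    apply: ler_pM; [exact: ler0n|exact: lnd|exact: sample_const_ge|].
    by rewrite ler_peMl// ler1n.
  apply: le_trans (restrict_sample_corr_le S n0 Sp (hdev n384)) _.
  rewrite -sqrtrM; last by apply: mulr_ge0 => //; exact: ltW.
  apply: ler_wsqrtr; rewrite -mulrA; apply: ler_wpM2l => //.
  by rewrite leNgt; apply/negP => /ltW h; apply: nF.
exists (E `&` E2); split; first exact: measurableI.
  move=> omega [Eo E2o] /=; rewrite ger0_norm ?frobenius_norm_ge0//.
  have [G0 Gle _] := Egood _ Eo.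
  have est := adaptive_est_good eps1_gt0 d0 Sp Ss SM Smin lam0 A2 A3 lamr G0 Gle.
  have gs := E2good _ Eo E2o.
  pose a l := frobenius_norm (adaptive_est (w n) (lambda n) (sample_corr (X n) omega) l
                - inv_correlation (Sigma n)).
  pose b := p2 / 2 * frobenius_norm (restrict_mx S (sample_corr (X n) omega - correlation (Sigma n))).
  have b0 : 0 <= b by rewrite mulr_ge0 ?frobenius_norm_ge0// divr_ge0.
  have ab l : (0 < l)%N -> a l <= b + 2^-1 * a l.-1.
    move=> l0; have [_ + _] := est l l0; rewrite gradient_loss// invmxK.
    by rewrite /b (_ : p2 / 2 = 8 * spectral_norm (inv_correlation (Sigma n)) ^+ 2)// /p2; lra.
  have a1 : a 1%N <= p2 * (lambda n * Num.sqrt (s n)%:R) by have [] := est 1%N isT.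
  apply: le_trans (geometric_contraction T0 b0 ab a1) _.
  have lamT : lambda n * Num.sqrt n%:R <= 2 ^+ (T n).
    by apply: pow2_ge_of_ln => //; rewrite mulr_gt0 ?sqrtr_gt0.
  set q := Num.sqrt ((s n)%:R / n%:R) in gs *.
  have q0 : 0 <= q by exact: sqrtr_ge0.
  have sq0 : 0 < Num.sqrt (n%:R : R) by rewrite sqrtr_gt0.
  have qE : q = Num.sqrt (s n)%:R / Num.sqrt n%:R.
    by rewrite /q sqrtrM ?ler0n// sqrtrV ?ler0n.
  have hb : 2 * b <= `|alpha| / 4 * Num.sqrt (12 * c) * q.
    have -> : 2 * b = p2 * frobenius_norm (restrict_mx S
        (sample_corr (X n) omega - correlation (Sigma n))) by rewrite /b; lra.
    by rewrite -mulrA; apply: ler_pM => //; exact: frobenius_norm_ge0.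
  (* Enough iterations have been made for [2 ^+ T] to absorb the excess factor [lambda * sqrt n]
     over the target rate. *)
  have hT2 : lambda n * Num.sqrt (s n)%:R / 2 ^+ (T n) <= q.
    rewrite qE mulrAC [leRHS]mulrC; apply: ler_wpM2r; first exact: sqrtr_ge0.
    by rewrite ler_pdivrMr ?exprn_gt0// mulrC ler_pdivlMr.
  have hc : 2 * (p2 * (lambda n * Num.sqrt (s n)%:R)) / 2 ^+ (T n) <=
      `|alpha| / 4 * 2 * q.
    have -> : 2 * (p2 * (lambda n * Num.sqrt (s n)%:R)) / 2 ^+ (T n) =
        p2 * (2 * (lambda n * Num.sqrt (s n)%:R / 2 ^+ (T n))).
      by rewrite mulrCA -!mulrA.
    rewrite -[leRHS]mulrA; apply: ler_pM => //; last by rewrite ler_pM2l.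
    apply: mulr_ge0 => //; apply: divr_ge0; last exact: exprn_ge0.
    by apply: mulr_ge0; [exact: ltW|exact: sqrtr_ge0].
  apply: le_trans (lerD hb hc) _; rewrite -mulrDl -mulrDr.
  by apply: ler_wpM2r; [exact: q0|rewrite lerDl ler01].
apply: le_trans (probability_setI_ge mE mE2 PE PE2).
by rewrite lee_fin; lra.
Unshelve. all: end_near. Qed.
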